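(* Let $V\subset V'$ be an immediate extension of valuation rings containing a field. Then $V'$ is a filtered union of its complete intersection $V$-subalgebras of finite type.
   Context: An extension of valuation rings $V\subset V'$ is immediate if the induced extensions of residue fields and of value groups are equalities. A complete intersection $V$-algebra is a local $V$-algebra of the form $C/(P)$, where $C$ is a localization of a polynomial $V$-algebra of finite type and $P$ is a regular sequence of elements of $C$.
   Formalization: ''Of finite type'' is read as ''essentially of finite type'': the local subalgebras are C/(P) with C a localization of a polynomial V-algebra in finitely many variables; literally finitely generated local subalgebras need not exist, e.g. for k[t]_(t) in k[[t]]. *)

(* Defs.v *)
From HB Require Import structures.
From mathcomp Require Import all_boot all_order all_algebra.
From mathcomp Require Import mpoly.
Set Implicit Arguments. Unset Strict Implicit. Unset Printing Implicit Defensive.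
Import GRing.Theory.
Local Open Scope ring_scope.

Definition rdvd (R : comRingType) (a b : R) : Prop := exists c : R, b = c * a.

Definition rassoc (R : comRingType) (a b : R) : Prop := rdvd a b /\ rdvd b a.

Definition runit (R : comRingType) (a : R) : Prop := exists b : R, a * b = 1.

(* A valuation ring: an integral domain in which divisibility is total
   (equivalently: for x in the fraction field, x or x^-1 lies in the ring). *)
Definition valuation_ring (V : idomainType) : Prop :=
  forall a b : V, rdvd a b \/ rdvd b a.

Definition contains_field (V : comRingType) : Prop :=
  exists (k : fieldType) (f : {rmorphism k -> V}), True.

(* V <= V' (via the injective ring map i) is an extension of valuation rings:
   both are valuation rings and V' dominates V (m_{V'} meets V in m_V, i.e.
   an element of V that becomes a unit in V' is a unit in V). *)
Definition valuation_ring_extension (V V' : idomainType) (i : {rmorphism V -> V'}) : Prop :=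
  [/\ valuation_ring V, valuation_ring V', injective i
    & forall a : V, runit (i a) -> runit a].

(* The induced map of value groups K^*/V^* -> K'^*/V'^* is onto:
   every nonzero element of K' = Frac V' is a unit of V' times an element of
   K^* = (Frac V)^*; it suffices to test on nonzero y in V' (K'^* = V'\0 / V'\0),
   where "y = u * a/b" reads "i b * y is associate to i a". *)
Definition same_value_group (V V' : idomainType) (i : {rmorphism V -> V'}) : Prop :=
  forall y : V', y != 0 ->
    exists a b : V, b != 0 /\ rassoc (i b * y) (i a).

Definition same_residue_field (V V' : idomainType) (i : {rmorphism V -> V'}) : Prop :=
  forall y : V', exists a : V, ~ runit (y - i a).

Definition immediate_extension (V V' : idomainType) (i : {rmorphism V -> V'}) : Prop :=
  [/\ valuation_ring_extension i, same_value_group i & same_residue_field i].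

Definition in_ideal (C : comRingType) (s : seq C) (x : C) : Prop :=
  exists c : seq C, size c = size s /\ x = \sum_(k < size s) c`_k * s`_k.

Definition regular_sequence (C : comRingType) (P : seq C) : Prop :=
  (forall k : nat, (k < size P)%N -> forall x : C,
      in_ideal (take k P) (x * P`_k) -> in_ideal (take k P) x)
  /\ ~ in_ideal P 1.

Definition multiplicative (R : comRingType) (S : R -> Prop) : Prop :=
  S 1 /\ forall a b, S a -> S b -> S (a * b).

Definition is_localization (R C : comRingType) (j : {rmorphism R -> C}) (S : R -> Prop) : Prop :=
  [/\ multiplicative S,
      forall s, S s -> runit (j s),
      forall c : C, exists a s, S s /\ c * j s = j a
    & forall a, j a = 0 -> exists s, S s /\ s * a = 0].

Definition local_subring (V' : comRingType) (A : V' -> Prop) : Prop :=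
  let unitA x := exists z, A z /\ x * z = 1 in
  forall x y, A x -> A y -> ~ unitA x -> ~ unitA y -> ~ unitA (x + y).

(* A is a complete intersection V-subalgebra of V': A is local, and there are
   a localization C of a polynomial V-algebra V[X_1..X_n], a regular sequence
   P of C and a V-algebra map phi : C -> V' with image A and kernel (P),
   i.e. A is isomorphic as a V-algebra to C/(P). *)
Definition ci_subalgebra (V V' : idomainType) (i : {rmorphism V -> V'}) (A : V' -> Prop) : Prop :=
  local_subring A /\
  exists (n : nat) (C : comRingType) (j : {rmorphism {mpoly V[n]} -> C})
         (S : {mpoly V[n]} -> Prop) (P : seq C) (phi : {rmorphism C -> V'}),
    [/\ is_localization j S, regular_sequence P,
        forall a : V, phi (j a%:MP) = i a,
        forall y : V', A y <-> exists c, phi c = y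
      & forall c, phi c = 0 <-> in_ideal P c].

Definition filtered_union (T : Type) (F : (T -> Prop) -> Prop) : Prop :=
  (forall y : T, exists A, F A /\ A y) /\
  (forall A B, F A -> F B -> exists D, F D /\ (forall y, A y -> D y) /\ (forall y, B y -> D y)).

(* Main.v *)
(* Let L = Frac V', with valuation ring O and K = Frac V.  Say that y in L is
   fixed by a local V-algebra A inside O if y = a u with a in K and u a unit of
   A.  It suffices that any finite set of nonzero elements of L is fixed by one
   complete intersection A, and the generators of L are adjoined one at a time.

   So let K1 be an intermediate field for which this holds, and x in the maximal
   ideal of O.  As the extension is immediate, the value of f(x), for f monic of
   degree e over K1 not vanishing at x, is never maximal.  Hence, given finitely
   many f of degree e, there is a monic Q of degree e with f = lc(f) Q + r, where
   r has lower degree and r(x) has smaller value than lc(f) Q(x).  By induction r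
   is already of the form a u; so either f is too, or it becomes so after the new
   variable Z = Q(x)/c is adjoined.  The relation defining Z reads c' Z = G(xi),
   where xi is the previous variable and G has a unit among its coefficients, the
   lower ones lying in the maximal ideal of V.  If x is algebraic, its minimal
   polynomial gives one last relation G(xi) = 0.

   The relations form a regular sequence and generate the full kernel because G
   is not a zero divisor modulo the previous relations and any d in the base:
   modulo these, xi^l u = - b h with b in the maximal ideal, so an element killed
   by G lies in every (b^n), hence vanishes by Krull's intersection theorem.  That
   theorem is applied in noetherian subrings generated by finitely many elements
   over the field contained in V. *)
Require Import Defs.
From HB Require Import structures.
From mathcomp Require Import all_boot all_order all_algebra.
From mathcomp Require Import mpoly.
From mathcomp Require Import ring.
From Stdlib Require Import Classical ClassicalEpsilon.
Set Implicit Arguments. Unset Strict Implicit. Unset Printing Implicit Defensive.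
Import GRing.Theory.
Local Open Scope ring_scope.

(** * Noetherian subrings *)

Definition subring (R : comNzRingType) (D : R -> Prop) : Prop :=
  [/\ D 1, forall x y, D x -> D y -> D (x - y)
    & forall x y, D x -> D y -> D (x * y)].

Definition ideal_of (R : comNzRingType) (D I : R -> Prop) : Prop :=
  [/\ forall x, I x -> D x, I 0, forall x y, I x -> I y -> I (x + y)
    & forall a x, D a -> I x -> I (a * x)].

(** The ascending chain condition. Ideals are predicates on the ambient ring, so that many subrings
    [D] of one ring can be handled without new ring types. *)
Definition noetherian (R : comNzRingType) (D : R -> Prop) : Prop :=
  forall I : nat -> R -> Prop, (forall n, ideal_of D (I n)) ->
    (forall n x, I n x -> I n.+1 x) ->
    exists N, forall n x, (N <= n)%N -> I n x -> I N x.

Definition poly_over (R : comNzRingType) (D : R -> Prop) (p : {poly R}) : Prop :=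
  forall k, D p`_k.

Lemma chain_mono (T : Type) (I : nat -> T -> Prop) :
  (forall n x, I n x -> I n.+1 x) ->
  forall m n x, (m <= n)%N -> I m x -> I n x.
Proof.
move=> hI m n x /subnK <-; elim: (n - m)%N => [//|k IH] h.
by rewrite addSn; apply/hI/IH.
Qed.

Section Subring.
Variables (R : comNzRingType) (D : R -> Prop).
Hypothesis D_ring : subring D.

Lemma subring1 : D 1. Proof. by case: D_ring. Qed.

Lemma subringB x y : D x -> D y -> D (x - y).
Proof. by case: D_ring => _ h _; apply: h. Qed.

Lemma subringM x y : D x -> D y -> D (x * y).
Proof. by case: D_ring => _ _; apply. Qed.

Lemma subring0 : D 0.
Proof. by rewrite -(subrr 1); apply: subringB; apply: subring1. Qed.

Lemma subringN x : D x -> D (- x).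
Proof. by move=> Dx; rewrite -sub0r; apply: subringB => //; apply: subring0. Qed.

Lemma subringD x y : D x -> D y -> D (x + y).
Proof. by move=> Dx Dy; rewrite -[y]opprK; apply: subringB => //; apply: subringN. Qed.

Lemma subringX x n : D x -> D (x ^+ n).
Proof.
move=> Dx; elim: n => [|n IH]; first by rewrite expr0; apply: subring1.
by rewrite exprS; apply: subringM.
Qed.

Lemma subring_sum (I : Type) (r : seq I) (P : pred I) (F : I -> R) :
  (forall i, P i -> D (F i)) -> D (\sum_(i <- r | P i) F i).
Proof.
move=> DF; apply: big_ind => //; [exact: subring0 | exact: subringD].
Qed.

Lemma idealB (I : R -> Prop) x y : ideal_of D I -> I x -> I y -> I (x - y).
Proof.
case=> _ _ hD hM Ix Iy; apply: hD => //; rewrite -mulN1r; apply: hM => //.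
by apply: subringN; apply: subring1.
Qed.

End Subring.

Section PolyOver.
Variables (R : comNzRingType) (D : R -> Prop).
Hypothesis D_ring : subring D.

Lemma poly_over_subring : subring (poly_over D).
Proof.
split=> [k|p q hp hq k|p q hp hq k].
- rewrite coef1; case: (k == 0%N); [exact: (subring1 D_ring) | exact: (subring0 D_ring)].
- by rewrite coefB; apply: (subringB D_ring).
- by rewrite coefM; apply: (subring_sum D_ring) => i _; apply: (subringM D_ring).
Qed.

Lemma poly_overC c : D c -> poly_over D c%:P.
Proof. by move=> Dc k; rewrite coefC; case: (k == 0%N) => //; apply: (subring0 D_ring). Qed.

Lemma poly_overX : poly_over D 'X.
Proof.
by move=> k; rewrite coefX; case: (k == 1%N); [apply: (subring1 D_ring) | apply: (subring0 D_ring)].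
Qed.

Let lead (I : {poly R} -> Prop) k (c : R) : Prop :=
  exists p, [/\ I p, (size p <= k.+1)%N & p`_k = c].

Lemma lead_ideal I k : ideal_of (poly_over D) I -> ideal_of D (lead I k).
Proof.
case=> h1 h2 h3 h4; split.
- by move=> x [p [Ip _ <-]]; apply: h1.
- by exists 0; rewrite size_poly0 coef0.
- move=> x y [p [Ip sp <-]] [q [Iq sq <-]]; exists (p + q); rewrite coefD; split=> //.
    by apply: h3.
  by rewrite (leq_trans (size_polyD _ _)) // geq_max sp.
- move=> a x Da [p [Ip sp <-]]; exists (a%:P * p); rewrite coefCM; split=> //.
    by apply: h4 => //; apply: poly_overC.
  by rewrite mul_polyC (leq_trans (size_scale_leq _ _)).
Qed.

(** Hilbert's basis theorem. The leading coefficients in degree n of [I n] form a diagonal chain in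
    [D], which stops at some [N]; the finitely many degrees below [N] stop together at some [M].
    Past [M], subtracting a polynomial of [I M] with the same top coefficient lowers the degree. *)
Lemma noetherian_poly : noetherian D -> noetherian (poly_over D).
Proof.
move=> nD I idI incI.
have leadS n k c : lead (I n) k c -> lead (I n) k.+1 c.
  case=> p [Ip sp <-]; exists ('X * p); split.
  - by case: (idI n) => _ _ _ h; apply: h => //; apply: poly_overX.
  - rewrite mulrC; case: (eqVneq p 0) => [->|p0]; first by rewrite mul0r size_poly0.
    by rewrite size_mulX.
  - by rewrite coefXM.
have leadk n k k' c : (k <= k')%N -> lead (I n) k c -> lead (I n) k' c.
  by move=> /subnK <-; elim: (k' - k)%N => [//|m IH] h; rewrite addSn; apply/leadS/IH.
have leadn n n' k c : (n <= n')%N -> lead (I n) k c -> lead (I n') k c.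
  by move=> le [p [Ip sp <-]]; exists p; split=> //; apply: (chain_mono incI le).
have [N hN] : exists N, forall n x, (N <= n)%N -> lead (I n) n x -> lead (I N) N x.
  apply: nD => [n|n x h]; first by apply: lead_ideal.
  by apply: leadS; apply: leadn h.
have [M [leNM hM]] : exists M, (N <= M)%N /\ forall k n x, (k < N)%N ->
    (M <= n)%N -> lead (I n) k x -> lead (I M) k x.
  elim: {2}N => [|K [M [leNM hM]]]; first by exists N.
  have [M' hM'] : exists M', forall n x, (M' <= n)%N -> lead (I n) K x -> lead (I M') K x.
    by apply: nD => [n|n x h]; [apply: lead_ideal | apply: leadn h].
  exists (maxn M M'); split=> [|k n x]; first by rewrite (leq_trans leNM) ?leq_maxl.
  rewrite ltnS leq_eqVlt => /orP[/eqP->|kK].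
    rewrite geq_max => /andP[_ le] h.
    by apply: leadn (hM' _ _ le h); rewrite leq_maxr.
  rewrite geq_max => /andP[le _] h.
  by apply: leadn (hM _ _ _ kK le h); rewrite leq_maxl.
exists M => n p leMn; have [s] := ubnP (size p); elim: s p => // s IH p.
case: (eqVneq p 0) => [-> _ _|p0 sp Ip]; first by case: (idI M).
have /prednK sp1 : (0 < size p)%N by rewrite lt0n size_poly_eq0.
set k := (size p).-1 in sp1.
have hc : lead (I n) k p`_k by exists p; rewrite sp1.
have [q [Iq sq eq]] : lead (I M) k p`_k.
  case: (ltnP k N) => kN; first exact: hM hc.
  (* In degree k at least [N], the coefficient is moved up to the diagonal at index max(k, n),
     brought down to [I N], and from there carried to [I M]. *)
  apply: (leadn N) => //; apply: (leadk _ _ _ _ kN); apply: (hN (maxn k n)).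
    by rewrite (leq_trans kN) ?leq_maxl.
  by apply: (leadk _ k); rewrite ?leq_maxl //; apply: (leadn n); rewrite ?leq_maxr.
have Iq' := chain_mono incI leMn Iq.
rewrite -[p](subrK q); case: (idI M) => _ _ hD _; apply: hD => //; apply: IH.
  have : (size (p - q)%R <= k)%N.
    apply/leq_sizeP => m; rewrite leq_eqVlt coefB => /orP[/eqP<-|km].
      by rewrite eq subrr.
    by rewrite !nth_default ?subrr // ?(leq_trans sq) // -sp1.
  by move=> h; apply: leq_ltn_trans h _; rewrite -ltnS sp1.
apply: (idealB poly_over_subring (idI n)) => //.
Qed.

Definition adjoin (t : R) : R -> Prop := fun x => exists p, poly_over D p /\ x = p.[t].

Lemma adjoin_subring t : subring (adjoin t).
Proof.
split=> [|_ _ [p [hp ->]] [q [hq ->]]|_ _ [p [hp ->]] [q [hq ->]]].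
- by exists 1; rewrite hornerC; split=> //; apply: (subring1 poly_over_subring).
- by exists (p - q); rewrite hornerD hornerN; split=> //; apply: (subringB poly_over_subring).
- by exists (p * q); rewrite hornerM; split=> //; apply: (subringM poly_over_subring).
Qed.

Lemma adjoin_base t x : D x -> adjoin t x.
Proof. by move=> Dx; exists x%:P; rewrite hornerC; split=> //; apply: poly_overC. Qed.

Lemma adjoin_gen t : adjoin t t.
Proof. by exists 'X; rewrite hornerX; split=> //; apply: poly_overX. Qed.

(** A chain of ideals of D[t] is pulled back to D[X] along evaluation at [t]. *)
Lemma noetherian_adjoin t : noetherian D -> noetherian (adjoin t).
Proof.
move=> nD I idI incI.
have [N hN] : exists N, forall n p, (N <= n)%N ->
    poly_over D p /\ I n p.[t] -> poly_over D p /\ I N p.[t].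
  apply: (noetherian_poly nD) => [n|n p [hp h]]; last by split=> //; apply: incI.
  case: (idI n) => h1 h2 h3 h4; split=> [p []//||p q [hp hp'] [hq hq']|a p ha [hp hp']].
  - by rewrite horner0; split=> // k; rewrite coef0; apply: (subring0 D_ring).
  - by rewrite hornerD; split; [apply: (subringD poly_over_subring) | apply: h3].
  - rewrite hornerM; split; first exact: (subringM poly_over_subring).
    by apply: h4 => //; exists a.
exists N => n x le Ix; have [p [hp ex]] : adjoin t x by case: (idI n) => h _ _ _; apply: h.
by move: Ix; rewrite ex => Ix; case: (hN n p).
Qed.

End PolyOver.

Definition range_of (A B : Type) (f : A -> B) : B -> Prop := fun y => exists x, y = f x.

Lemma range_subring (k R : comNzRingType) (f : {rmorphism k -> R}) : subring (range_of f).
Proof.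
split=> [|_ _ [x ->] [y ->]|_ _ [x ->] [y ->]].
- by exists 1; rewrite rmorph1.
- by exists (x - y); rewrite rmorphB.
- by exists (x * y); rewrite rmorphM.
Qed.

(** The image of a field has only two ideals, so a chain is constant from any nonzero member on. *)
Lemma noetherian_field (k : fieldType) (R : comNzRingType) (f : {rmorphism k -> R}) :
  noetherian (range_of f).
Proof.
move=> I idI incI.
case: (classic (exists n x, I n x /\ x != 0)) => [[N [x [Ix x0]]]|h].
  exists N => n y le Iy; case: (idI N) => h1 _ _ h4.
  have [a ex] := h1 _ Ix; have [b ->] : range_of f y by case: (idI n) => h _ _ _; apply: h Iy.
  have a0 : a != 0 by apply: contraNneq x0 => a0; rewrite ex a0 rmorph0.
  rewrite -(divfK a0 b) rmorphM -ex; apply: h4 => //; by exists (b / a).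
exists 0%N => n x _ Ix; case: (eqVneq x 0) => [->|x0]; first by case: (idI 0%N).
by case: h; exists n, x.
Qed.

Lemma noetherian_fg (k : fieldType) (R : comNzRingType) (f : {rmorphism k -> R}) (l : seq R) :
  exists D : R -> Prop, [/\ subring D, noetherian D & forall x, x \in l -> D x].
Proof.
elim: l => [|t l [D [rD nD hD]]].
  by exists (range_of f); split=> //; [apply: range_subring | apply: noetherian_field].
exists (adjoin D t); split; [exact: adjoin_subring | exact: noetherian_adjoin|].
move=> x; rewrite inE => /orP[/eqP->|/hD Dx]; first exact: adjoin_gen.
exact: adjoin_base.
Qed.

(** * Regular elements and Krull's argument *)

Definition is_ideal (R : comNzRingType) (I : R -> Prop) : Prop :=
  ideal_of (fun _ => True) I.

(** The intersection of all ideals containing [P]; membership then serves directly as an induction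
    principle, and [gen_in_ideal] translates it into lists of coefficients. *)
Definition gen (R : comNzRingType) (P : seq R) (x : R) : Prop :=
  forall I, is_ideal I -> (forall p, p \in P -> I p) -> I x.

Section Gen.
Variable R : comNzRingType.
Implicit Types (P : seq R) (x y : R).

Lemma is_ideal0 (I : R -> Prop) : is_ideal I -> I 0. Proof. by case. Qed.

Lemma is_idealD (I : R -> Prop) x y : is_ideal I -> I x -> I y -> I (x + y).
Proof. by case=> _ _ h _; apply: h. Qed.

Lemma is_idealMl (I : R -> Prop) a x : is_ideal I -> I x -> I (a * x).
Proof. by case=> _ _ _ h; apply: h. Qed.

Lemma is_idealMr (I : R -> Prop) a x : is_ideal I -> I x -> I (x * a).
Proof. by rewrite mulrC; apply: is_idealMl. Qed.

Lemma is_idealN (I : R -> Prop) x : is_ideal I -> I x -> I (- x).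
Proof. by rewrite -mulN1r; apply: is_idealMl. Qed.

Lemma is_idealB (I : R -> Prop) x y : is_ideal I -> I x -> I y -> I (x - y).
Proof. by move=> hI Ix Iy; apply: is_idealD => //; apply: is_idealN. Qed.

Lemma gen_ideal P : is_ideal (gen P).
Proof.
split=> // [I hI _|x y hx hy I hI hP|a x _ hx I hI hP]; first exact: is_ideal0.
- by apply: is_idealD => //; [apply: hx | apply: hy].
- by apply: is_idealMl => //; apply: hx.
Qed.

Lemma gen_mem P p : p \in P -> gen P p.
Proof. by move=> hp I _; apply. Qed.

Lemma gen_sub P Q x : (forall p, p \in P -> gen Q p) -> gen P x -> gen Q x.
Proof. by move=> h; apply=> //; apply: gen_ideal. Qed.

Lemma gen_subset P Q x : {subset P <= Q} -> gen P x -> gen Q x.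
Proof. by move=> h; apply: gen_sub => p /h; apply: gen_mem. Qed.

Lemma gen_cons p P x : gen (p :: P) x <-> exists y c, gen P y /\ x = y + c * p.
Proof.
split=> [h|[y [c [hy ->]]]].
  pattern x; apply: h; last first => [q|].
    rewrite inE => /orP[/eqP->|qP]; last by exists q, 0; rewrite mul0r addr0; split=> //; apply: gen_mem.
    by exists 0, 1; rewrite mul1r add0r; split=> //; exact: (is_ideal0 (gen_ideal _)).
  split=> //.
  - by exists 0, 0; rewrite mul0r addr0; split=> //; exact: (is_ideal0 (gen_ideal _)).
  - move=> _ _ [y [c [hy ->]]] [y' [c' [hy' ->]]]; exists (y + y'), (c + c').
    by split; [apply: (is_idealD (gen_ideal _)) | ring].
  - move=> a _ _ [y [c [hy ->]]]; exists (a * y), (a * c).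
    by split; [apply: (is_idealMl _ (gen_ideal _)) | ring].
apply: (is_idealD (gen_ideal _)).
  by apply: gen_subset hy => q qP; rewrite inE qP orbT.
by apply: (is_idealMl _ (gen_ideal _)); apply: gen_mem; rewrite inE eqxx.
Qed.

Lemma gen_rcons p P x : gen (rcons P p) x <-> exists y c, gen P y /\ x = y + c * p.
Proof.
rewrite -gen_cons; split; apply: gen_subset => q; by rewrite mem_rcons.
Qed.

End Gen.

Section GenPoly.
Variable R : comNzRingType.
Implicit Types (P : seq R) (x y : R).

Lemma poly_ideal (I : R -> Prop) : is_ideal I -> is_ideal (poly_over I).
Proof.
move=> hI; split=> // [k|p q hp hq k|p q _ hq k].
- by rewrite coef0; apply: is_ideal0.
- by rewrite coefD; apply: is_idealD.
- rewrite coefM; apply: big_ind => [|x y|i _]; first exact: is_ideal0.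
    exact: is_idealD.
  exact: is_idealMl.
Qed.

(** Makes membership in the extended ideal a matter of coefficients, since the polynomials with
    coefficients in (P) already form an ideal. *)
Lemma gen_polyC P (p : {poly R}) : gen (map polyC P) p <-> poly_over (gen P) p.
Proof.
split=> [|hp].
  move=> h; apply: h; first exact: (poly_ideal (gen_ideal _)).
  move=> _ /mapP[q qP ->] k; rewrite coefC; case: (k == 0%N); first exact: gen_mem.
  exact: (is_ideal0 (gen_ideal _)).
rewrite -[p]coefK poly_def; have idP := gen_ideal (map polyC P).
apply: big_ind => [|x y|i _]; [exact: (is_ideal0 idP) | exact: (is_idealD idP) |].
rewrite -mul_polyC; apply: (is_idealMr _ idP).
suff h c : gen P c -> gen (map polyC P) c%:P by exact: (h _ (hp _)).
move=> h; pattern c; apply: h => [|q qP]; last by apply: gen_mem; apply: map_f.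
split=> // [|x y hx hy|a x _ hx].
- by rewrite polyC0; exact: (is_ideal0 idP).
- by rewrite polyCD; apply: (is_idealD idP).
- by rewrite polyCM; apply: (is_idealMl _ idP).
Qed.

Lemma gen_in_ideal P x : gen P x <-> in_ideal P x.
Proof.
split=> [h|].
  pattern x; apply: h => [|p pP].
    split=> //.
    - exists (nseq (size P) 0); rewrite size_nseq; split=> //.
      by rewrite big1 // => i _; rewrite nth_nseq if_same mul0r.
    - move=> _ _ [c [sc ->]] [d [sd ->]]; exists [seq c`_k + d`_k | k <- iota 0 (size P)].
      rewrite size_map size_iota -big_split; split=> //; apply: eq_bigr => k _ /=.
      by rewrite (nth_map 0%N) ?size_iota // nth_iota // mulrDl.
    - move=> a _ _ [c [sc ->]]; exists [seq a * c`_k | k <- iota 0 (size P)].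
      rewrite size_map size_iota mulr_sumr; split=> //; apply: eq_bigr => k _ /=.
      by rewrite (nth_map 0%N) ?size_iota // nth_iota // mulrA.
  exists [seq (k == index p P)%:R | k <- iota 0 (size P)].
  rewrite size_map size_iota; split=> //.
  have hi : (index p P < size P)%N by rewrite index_mem.
  rewrite (bigD1 (Ordinal hi)) //= (nth_map 0%N) ?size_iota // nth_iota // eqxx mul1r.
  rewrite nth_index // big1 ?addr0 // => k.
  rewrite -val_eqE /= => /negPf kn.
  by rewrite (nth_map 0%N) ?size_iota // nth_iota // add0n kn mul0r.
case=> c [sc ->]; have idP := gen_ideal P.
apply: big_ind => [|y z|i _]; [exact: (is_ideal0 idP) | exact: (is_idealD idP) |].
by apply: (is_idealMl _ idP); apply: gen_mem; apply: mem_nth.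
Qed.

End GenPoly.

Lemma gen_rmorph (R R' : comNzRingType) (f : {rmorphism R -> R'}) P x :
  gen P x -> gen (map f P) (f x).
Proof.
have idP := gen_ideal (map f P).
move=> h; pattern x; apply: h => [|p pP]; last by apply: gen_mem; apply: map_f.
split=> // [|a b ha hb|a b _ hb].
- by rewrite rmorph0; apply: (is_ideal0 idP).
- by rewrite rmorphD; apply: (is_idealD idP).
- by rewrite rmorphM; apply: (is_idealMl _ idP).
Qed.

(** * Regular variables and the cancellation of regular elements *)

Section Filtration.
Variables (V : comNzRingType) (mV : V -> Prop).

(* F is a stock of ideals of D modulo which xi is a non-zero-divisor (up to S)
   and which stays closed under adding the elements of the maximal ideal of V. *)
Definition filtration (R : comNzRingType) (S : R -> Prop) (kap : V -> R) (xi : R)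
    (D : R -> Prop) (F : (R -> Prop) -> Prop) : Prop :=
  [/\ [/\ subring D, noetherian D & D xi],
      forall J, F J -> ideal_of D J,
      forall J b, F J -> mV b -> D (kap b) -> exists J', F J' /\
        forall y, J' y <-> exists j d, [/\ J j, D d & y = j + kap b * d]
    & forall J y, F J -> D y -> J (xi * y) -> exists s, [/\ S s, D s & J (s * y)]].

(* R itself need not be noetherian; any finite amount of data in R and in I is
   caught in a noetherian subring D and an ideal J of D contained in I. *)
Definition regular_var (R : comNzRingType) (S : R -> Prop) (kap : V -> R) (xi : R)
    (I : R -> Prop) : Prop :=
  forall l l' : seq R, (forall y, y \in l' -> I y) ->
  exists D F J, [/\ filtration S kap xi D F, forall y, y \in l -> D y, F J,
    forall y, y \in l' -> J y & forall y, J y -> I y].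

(** Models a polynomial in [xi] whose coefficients below degree [l] lie in the maximal ideal of [V]:
    [b] is a common divisor of these, and [u] collects the terms from degree [l] on. *)
Definition regular_elt (R : comNzRingType) (S : R -> Prop) (kap : V -> R) (xi : R)
    (G : R) : Prop :=
  exists b h l u, [/\ mV b, S u & G = kap b * h + xi ^+ l * u].

Hypothesis mVM : forall a b, mV b -> mV (b * a).

Section Krull.
Variables (R : comNzRingType) (S : R -> Prop) (kap : {rmorphism V -> R}) (xi : R).
Hypothesis S1 : S 1.
Hypothesis SM : forall s t, S s -> S t -> S (s * t).
Hypothesis SmV : forall s b x, S s -> mV b -> S (s + kap b * x).

Lemma SX s n : S s -> S (s ^+ n).
Proof. by move=> Ss; elim: n => [|n IH]; rewrite ?expr0 // exprS; apply: SM. Qed.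

(** Modulo J, (xi^l u)^n y equals (- b h)^n y, so it lies in J + (b^n). As [xi] cancels modulo J +
    (b^n), a multiple of y by an element of [S] lies there for every n. The chain condition then
    replaces the intersection over all n by a single large n. *)
Lemma krull D F J b h l u y : filtration S kap xi D F -> F J ->
  mV b -> D (kap b) -> D h -> D u -> S u -> D y ->
  J ((kap b * h + xi ^+ l * u) * y) -> exists s, [/\ S s, D s & J (s * y)].
Proof.
case=> [[rD nD Dxi] idF addF xiF] FJ mb Db Dh Du Su Dy Jy.
have idJ := idF _ FJ.
have [JD J0 JA JM] := idJ.
have xiX J' k z : F J' -> D z -> J' (xi ^+ k * z) -> exists s, [/\ S s, D s & J' (s * z)].
  move=> FJ'; have [_ _ _ JM'] := idF _ FJ'.
  elim: k z => [|k IH] z Dz; first by rewrite expr0 mul1r => h0; exists 1; rewrite mul1r; split=> //; apply: subring1.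
  rewrite exprSr -mulrA => /IH[|s [Ss Ds]]; first exact: subringM.
  rewrite mulrCA => /xiF[||t [St Dt Jt]] //; first exact: subringM.
  by exists (t * s); rewrite -mulrA; split=> //; [apply: SM | apply: subringM].
have approx n : exists s j d, [/\ S s, D s, J j, D d & s * y = j + kap b ^+ n * d].
  case: n => [|n]; first by exists 1, 0, y; split=> //; [apply: subring1 | ring].
  have [J' [FJ' hJ']] : exists J', F J' /\
      forall y, J' y <-> exists j d, [/\ J j, D d & y = j + kap (b ^+ n.+1) * d].
    apply: addF => //; first by rewrite exprS; apply: mVM.
    by rewrite rmorphXn; apply: subringX.
  have : J' (xi ^+ (l * n.+1) * (u ^+ n.+1 * y)).
    apply/hJ'; exists (xi ^+ (l * n.+1) * (u ^+ n.+1 * y) - (- (kap b * h)) ^+ n.+1 * y).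
    exists ((- h) ^+ n.+1 * y); split; last first.
    - have -> : (- (kap b * h)) ^+ n.+1 = kap b ^+ n.+1 * (- h) ^+ n.+1 by rewrite -exprMn mulrN.
      by rewrite rmorphXn; ring.
    - by apply: subringM => //; apply: subringX => //; apply: subringN.
    (* The difference of two powers with equal exponent is a multiple of the difference of their
       bases, here b h + xi^l u, which sends y into J. *)
    - have e c : (xi ^+ l * u - - (kap b * h)) * c * y = c * ((kap b * h + xi ^+ l * u) * y) by ring.
      rewrite mulrA exprM -exprMn -mulrBl subrXX e.
      apply: JM => //; apply: subring_sum => // i _.
      by apply: subringM => //; apply: subringX => //; [|apply: subringN => //]; apply: subringM => //; apply: subringX.
  case/xiX => //; first by apply: subringM => //; apply: subringX.
  move=> s [Ss Ds]; rewrite mulrA => /hJ'[j [d [Jj Dd]]]; rewrite rmorphXn => e.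
  exists (s * u ^+ n.+1), j, d; split=> //; first by apply: SM => //; apply: SX.
  by apply: subringM => //; apply: subringX.
(* Herstein's proof of Krull's theorem: the ideals (J + y D : b^n) stabilize *)
pose I n w := D w /\ exists j d, [/\ J j, D d & kap b ^+ n * w = j + d * y].
have [N hN] : exists N, forall n w, (N <= n)%N -> I n w -> I N w.
  apply: nD => [n|n w [Dw [j [d [Jj Dd e]]]]].
    split=> [w []//||w w' [Dw [j [d [Jj Dd e]]]] [Dw' [j' [d' [Jj' Dd' e']]]]|a w Da [Dw [j [d [Jj Dd e]]]]].
    - by split; [|exists 0, 0; split=> //; [|ring]]; apply: subring0.
    - split; first exact: subringD.
      by exists (j + j'), (d + d'); split; [apply: JA | apply: subringD | rewrite mulrDr e e'; ring].
    - split; first exact: subringM.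
      by exists (a * j), (a * d); split; [apply: JM | apply: subringM | rewrite mulrCA e; ring].
  split=> //; exists (kap b * j), (kap b * d).
  by split; [apply: JM | apply: subringM | rewrite exprS -mulrA e; ring].
have [s [j [d [Ss Ds Jj Dd e]]]] := approx N.+1.
(* From s y = j + b^(N+1) d, the element d is in [I N.+1], hence in [I N]: b^N d = j' + d' y.
   Substituting gives (s - b d') y in J, and s - b d' is still in [S] because b is in the maximal
   ideal. *)
have [_ [j' [d' [Jj' Dd' e']]]] : I N d.
  apply: (hN N.+1) => //; split=> //; exists (- j), s; split=> //; last by rewrite e; ring.
  by rewrite -sub0r; apply: (idealB rD idJ).
exists (s - kap b * d'); split; first by rewrite -mulrN; apply: SmV.
  by apply: subringB => //; apply: subringM.
have -> : (s - kap b * d') * y = j + kap b * j'.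
  by rewrite mulrBl e exprS -mulrA e'; ring.
by apply: JA => //; apply: JM.
Qed.

(** Only finitely many elements occur, so [regular_var] places them in a noetherian subring where
    [krull] applies. *)
Lemma regular_elt_nzd (I : R -> Prop) G y : regular_var S kap xi I ->
  regular_elt S kap xi G -> I (G * y) -> exists s, S s /\ I (s * y).
Proof.
move=> hI [b [h [l [u [mb Su eG]]]]] IGy.
have [D [F [J [hF hl FJ hl' JI]]]] := hI [:: kap b; h; u; y] [:: G * y]
  ltac:(by move=> z; rewrite inE => /eqP->).
have [s [Ss _ Js]] : exists s, [/\ S s, D s & J (s * y)].
  apply: (krull (b := b) (h := h) (l := l) (u := u) hF FJ) => //;
    try by apply: hl; rewrite !inE eqxx ?orbT.
  by rewrite -eG; apply: hl'; rewrite inE.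
by exists s; split=> //; apply: JI.
Qed.

End Krull.

(** The ideal of R[Z] generated by [I] and the relation e Z - G that introduces the new variable
    Z. *)
Definition link_ideal (R : comNzRingType) (I : R -> Prop) (e G : R) (y : {poly R}) : Prop :=
  exists y1 q, poly_over I y1 /\ y = y1 + (e%:P * 'X - G%:P) * q.

(** If Z y lies in J[Z] + (e Z - G), setting Z = 0 leaves a relation in which [G] multiplies an
    element into J, and [krull] cancels [G]. Thus regularity passes from [xi] to the next
    variable. *)
Lemma regular_var_link (R : comNzRingType) (S : R -> Prop) (kap : {rmorphism V -> R}) (xi : R)
    (S' : {poly R} -> Prop) (I : R -> Prop) (e G : R) :
  S 1 -> (forall s t, S s -> S t -> S (s * t)) ->
  (forall s b x, S s -> mV b -> S (s + kap b * x)) ->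
  (forall s, S s -> S' s%:P) ->
  regular_var S kap xi I -> regular_elt S kap xi G ->
  regular_var S' (fun a => (kap a)%:P) 'X (link_ideal I e G).
Proof.
move=> S1 SM SmV SS' hI [b [h [l0 [u [mb Su eG]]]]] l l' Il'.
(* Witnesses for the members of [l'] are fixed and their coefficients collected, those from [I] in
   [m.2] and the cofactors in [m.1], to be caught by the noetherian subring chosen next. *)
have [m hm] : exists m : seq R * seq R, (forall x, x \in m.2 -> I x) /\
    forall y, y \in l' -> exists y1 q : {poly R}, [/\ forall k, y1`_k \in 0 :: m.2,
      forall k, q`_k \in 0 :: m.1 & y = y1 + (e%:P * 'X - G%:P) * q].
  elim: l' Il' => [|y l' IH] Il'; first by exists ([::], [::]).
  have [|[m1 m2] [/= hm2 hm]] := IH; first by move=> z zl; apply: Il'; rewrite inE zl orbT.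
  have [y1 [q [Iy1 ey]]] := Il' y ltac:(by rewrite inE eqxx).
  have coef_in (p : {poly R}) s k : p`_k \in 0 :: (p ++ s).
    case: (ltnP k (size p)) => kp; last by rewrite nth_default // inE eqxx.
    by rewrite inE mem_cat mem_nth ?orbT.
  exists (q ++ m1, y1 ++ m2); split=> [x /=|z].
    rewrite mem_cat => /orP[/(nthP 0)[k _ <-]|/hm2] //; exact: Iy1.
  rewrite inE => /orP[/eqP->|/hm[z1 [r [hz1 hr ez]]]].
    by exists y1, q; split=> // k; apply: coef_in.
  exists z1, r; split=> // k.
    by move: (hz1 k); rewrite !inE mem_cat => /orP[->|->]; rewrite ?orbT.
  by move: (hr k); rewrite !inE mem_cat => /orP[->|->]; rewrite ?orbT.
case: m hm => m1 m2 [/= Im2 hm].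
have [D [F [J [hF hl FJ hl' JI]]]] := hI ([:: kap b; h; u; G; e] ++ m1 ++ flatten (map polyseq l)) m2 Im2.
have [[rD nD Dxi] idF addF xiF] := hF.
have DG : D G by apply: hl; rewrite !inE eqxx !orbT.
have De : D e by apply: hl; rewrite !inE eqxx !orbT.
have rD' := poly_over_subring rD.
pose r := e%:P * 'X - G%:P.
have Dr : poly_over D r.
  apply: (subringB rD'); last exact: poly_overC.
  by apply: (subringM rD'); [apply: poly_overC | apply: poly_overX].
(* The new stock of ideals of D[Z]: J[Z] + (e Z - G), for J in the old stock. *)
pose K J (y : {poly R}) := exists y1 q, [/\ poly_over J y1, poly_over D q & y = y1 + r * q].
have polyJ J0 : F J0 -> ideal_of (poly_over D) (poly_over J0).
  move=> FJ0; have [JD J00 JA JM] := idF _ FJ0; split=> [p hp k|k|p q hp hq k|p q hp hq k].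
  - exact/JD/hp.
  - by rewrite coef0.
  - by rewrite coefD; apply: JA.
  - by rewrite coefM; apply: big_ind => // i _; apply: JM.
have idK J0 : F J0 -> ideal_of (poly_over D) (K J0).
  move=> /polyJ[JD J00 JA JM]; split.
  - move=> _ [y1 [q [hy hq ->]]]; apply: (subringD rD'); first exact: JD.
    exact: (subringM rD').
  - by exists 0, 0; split=> //; [apply: (subring0 rD') | ring].
  - move=> _ _ [y1 [q [hy hq ->]]] [y2 [q2 [hy2 hq2 ->]]]; exists (y1 + y2), (q + q2).
    by split; [apply: JA | apply: (subringD rD') | ring].
  - move=> a _ Da [y1 [q [hy hq ->]]]; exists (a * y1), (a * q).
    by split; [apply: JM | apply: (subringM rD') | ring].
exists (poly_over D), (fun J' => exists2 J0, F J0 & J' = K J0), (K J); split.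
- split.
  + by split=> //; [apply: noetherian_poly | apply: poly_overX].
  + by move=> _ [J0 FJ0 ->]; apply: idK.
  + move=> _ c [J0 FJ0 ->] mc Dc.
    have Dc' : D (kap c) by move: (Dc 0%N); rewrite coefC eqxx.
    have [J1 [FJ1 hJ1]] := addF _ _ FJ0 mc Dc'.
    exists (K J1); split=> [|y]; first by exists J1.
    split=> [[y1 [q [hy hq ->]]]|[j [d [[y1 [q [hy hq ->]]] hd ->]]]].
      have [f hf] : exists f : nat -> R * R, forall k, [/\ J0 (f k).1, D (f k).2 &
          y1`_k = (f k).1 + kap c * (f k).2].
        have h0 k : exists jd : R * R, [/\ J0 jd.1, D jd.2 & y1`_k = jd.1 + kap c * jd.2].
          by have [j [d hjd]] := (hJ1 _).1 (hy k); exists (j, d).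
        by exists (fun k => proj1_sig (constructive_indefinite_description _ (h0 k))) => k;
           case: constructive_indefinite_description.
      exists (\poly_(k < size y1) (f k).1 + r * q), (\poly_(k < size y1) (f k).2).
      have [JD J00 JA JM] := idF _ FJ0.
      split.
      * exists (\poly_(k < size y1) (f k).1), q; split=> // k.
        by rewrite coef_poly; case: ifP => // _; case: (hf k).
      * move=> k; rewrite coef_poly; case: ifP => // _; last exact: subring0.
        by case: (hf k).
      * rewrite addrAC; congr (_ + _); apply/polyP => k.
        rewrite coefD coefCM !coef_poly; case: (ltnP k (size y1)) => ks.
          by case: (hf k).
        by rewrite nth_default // mulr0 addr0.
    exists (y1 + (kap c)%:P * d), q; split=> // [k|]; last by ring.
    by apply/hJ1; exists y1`_k, d`_k; rewrite coefD coefCM.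
  + move=> _ y [J0 FJ0 ->] Dy [y1 [q [hy hq ey]]].
    have [JD J00 JA JM] := idF _ FJ0; have [pJD pJ0 pJA pJM] := polyJ _ FJ0.
    (* Constant coefficients in Z y = y1 + r q, where r has constant coefficient - G. *)
    have : J0 (G * q`_0).
      have -> : G * q`_0 = y1`_0.
        have := congr1 (fun p : {poly R} => p`_0) ey.
        rewrite coefXM eqxx coefD /r mulrBl coefB -mulrA coefCM coefXM eqxx coefCM mulr0 sub0r.
        by move/esym/eqP; rewrite subr_eq0 => /eqP.
      exact: hy.
    rewrite eG => /(krull S1 SM SmV hF FJ0)[] //; try by apply: hl; rewrite !inE eqxx ?orbT.
    move=> s [Ss Ds Jsq].
    exists s%:P; split; [exact: SS' | exact: poly_overC |].
    pose q' := \poly_(k < size q) q`_k.+1.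
    have eq' : q = (q`_0)%:P + 'X * q'.
      apply/polyP=> k; rewrite coefD coefC coefXM; case: k => [|k] /=; first by rewrite addr0.
      rewrite add0r coef_poly; case: ltnP => // ks.
      by rewrite nth_default // (leq_trans ks).
    have Dq' : poly_over D q'.
      by move=> k; rewrite coef_poly; case: ifP => // _; apply: subring0.
    (* With q = q_0 + Z q', the product Z (y - r q') equals y1 + r q_0, and s q_0 is in J. Dividing
       the coefficients' index by one step then puts s (y - r q') itself in J[Z]. *)
    have Jx : poly_over J0 ('X * (s%:P * (y - r * q'))).
      have -> : 'X * (s%:P * (y - r * q')) = s%:P * y1 + r * (s * q`_0)%:P.
        rewrite polyCM !mulrBr [in 'X * (s%:P * y)]mulrCA ey {1}eq'; ring.
      apply: pJA; first by apply: pJM => //; apply: poly_overC.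
      by apply: pJM => // k; rewrite coefC; case: ifP.
    exists (s%:P * (y - r * q')), (s%:P * q'); split.
    * by move=> k; move: (Jx k.+1); rewrite coefXM.
    * by apply: (subringM rD') => //; apply: poly_overC.
    * ring.
- move=> y yl k; case: (ltnP k (size y)) => ky; last by rewrite nth_default //; apply: subring0.
  apply: hl; rewrite !mem_cat; apply/orP; right; apply/orP; right.
  by apply/flattenP; exists (polyseq y); [apply: map_f | apply: mem_nth].
- by exists J.
- have [JD J00 JA JM] := idF _ FJ.
  move=> y /hm[y1 [q [hy hq ey]]]; exists y1, q; split=> // k.
    by move: (hy k); rewrite inE => /orP[/eqP->|/hl'].
  move: (hq k); rewrite inE => /orP[/eqP->|qm]; first exact: subring0.
  by apply: hl; rewrite !mem_cat qm !orbT.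
- by move=> y [y1 [q [hy hq ->]]]; exists y1, q; split=> // k; apply: JI.
Qed.

(** X cancels modulo J[X] for every ideal J of D, so the stock may contain all of these. The field
    supplies a noetherian D containing the given coefficients. *)
Lemma regular_var_base (k : fieldType) (R : comNzRingType) (f : {rmorphism k -> R})
    (kap : {rmorphism V -> R}) (S : {poly R} -> Prop) (I : R -> Prop) :
  S 1 -> is_ideal I -> regular_var S (fun a => (kap a)%:P) 'X (poly_over I).
Proof.
move=> S1 idI l l' Il'.
have [D [rD nD hD]] := noetherian_fg f (flatten (map polyseq (l ++ l'))).
have rD' := poly_over_subring rD.
have Dl y : y \in l ++ l' -> poly_over D y.
  move=> yl m; case: (ltnP m (size y)) => ky; last by rewrite nth_default //; apply: subring0.
  by apply: hD; apply/flattenP; exists (polyseq y); [apply: map_f | apply: mem_nth].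
have polyJ J : ideal_of D J -> ideal_of (poly_over D) (poly_over J).
  move=> [JD J00 JA JM]; split=> [p hp m|m|p q hp hq m|p q hp hq m].
  - exact/JD/hp.
  - by rewrite coef0.
  - by rewrite coefD; apply: JA.
  - by rewrite coefM; apply: big_ind => // i _; apply: JM.
exists (poly_over D), (fun J' => exists2 J, ideal_of D J & J' = poly_over J),
  (poly_over (fun y => D y /\ I y)); split.
- split.
  + by split=> //; [apply: noetherian_poly | apply: poly_overX].
  + by move=> _ [J idJ ->]; apply: polyJ.
  + move=> _ c [J idJ ->] mc Dc.
    have Dc' : D (kap c) by move: (Dc 0%N); rewrite coefC eqxx.
    have [JD J00 JA JM] := idJ.
    exists (poly_over (fun y => exists j d, [/\ J j, D d & y = j + kap c * d])); split.
      exists (fun y => exists j d, [/\ J j, D d & y = j + kap c * d]) => //; split.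
      * by move=> _ [j [d [Jj Dd ->]]]; apply: subringD => //; [apply: JD | apply: subringM].
      * by exists 0, 0; split=> //; [apply: subring0 | ring].
      * move=> _ _ [j [d [Jj Dd ->]]] [j' [d' [Jj' Dd' ->]]]; exists (j + j'), (d + d').
        by split; [apply: JA | apply: subringD | ring].
      * move=> a _ Da [j [d [Jj Dd ->]]]; exists (a * j), (a * d).
        by split; [apply: JM | apply: subringM | ring].
    move=> y; split=> [hy|[j [d [hj hd ->]]] m]; last first.
      by exists j`_m, d`_m; rewrite coefD coefCM.
    have [g hg] : exists g : nat -> R * R, forall k, [/\ J (g k).1, D (g k).2 &
          y`_k = (g k).1 + kap c * (g k).2].
      have h0 m : exists jd : R * R, [/\ J jd.1, D jd.2 & y`_m = jd.1 + kap c * jd.2].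
        by have [j [d hjd]] := hy m; exists (j, d).
      by exists (fun k => proj1_sig (constructive_indefinite_description _ (h0 k))) => m;
         case: constructive_indefinite_description.
    exists (\poly_(k < size y) (g k).1), (\poly_(k < size y) (g k).2); split.
    * by move=> m; rewrite coef_poly; case: ifP => // _; case: (hg m).
    * move=> m; rewrite coef_poly; case: ifP => // _; last exact: subring0.
      by case: (hg m).
    * apply/polyP => m; rewrite coefD coefCM !coef_poly; case: (ltnP m (size y)) => ks.
        by case: (hg m).
      by rewrite nth_default // mulr0 addr0.
  + move=> _ y [J idJ ->] Dy hy; exists 1; rewrite mul1r; split=> //; first exact: (subring1 rD').
    by move=> m; move: (hy m.+1); rewrite coefXM.
- by move=> y yl; apply: Dl; rewrite mem_cat yl.
- exists (fun y => D y /\ I y) => //; split=> [x []//||x y [Dx Ix] [Dy Iy]|a x Da [Dx Ix]].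
  + by split; [apply: subring0 | apply: is_ideal0].
  + by split; [apply: subringD | apply: is_idealD].
  + by split; [apply: subringM | apply: is_idealMl].
- by move=> y yl m; split; [apply: Dl; rewrite mem_cat yl orbT | apply: Il'].
- by move=> y hy m; case: (hy m).
Qed.

End Filtration.

(** * Polynomial algebras *)

(** A polynomial algebra up to isomorphism, so that variables can be adjoined one at a time as
    iterated univariate polynomial rings. *)
Definition poly_algebra (V R : comNzRingType) (kap : V -> R) : Prop :=
  exists n (f : {rmorphism {mpoly V[n]} -> R}) (g : {rmorphism R -> {mpoly V[n]}}),
    [/\ cancel f g, cancel g f & forall a, f a%:MP = kap a].

Lemma mpoly_rmorph_ext (V R : comNzRingType) n (f g : {rmorphism {mpoly V[n]} -> R}) :
  (forall a, f a%:MP = g a%:MP) -> (forall i, f 'X_i = g 'X_i) -> f =1 g.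
Proof.
move=> fgC fgX p; rewrite (mpolyE p) !rmorph_sum; apply: eq_bigr => m _ /=.
rewrite -mul_mpolyC !rmorphM fgC mpolyXE_id !rmorph_prod; congr (_ * _).
by apply: eq_bigr => i _; rewrite !rmorphXn fgX.
Qed.

Lemma poly_algebra0 (V : comNzRingType) : poly_algebra (@idfun V).
Proof.
pose f : {rmorphism {mpoly V[0]} -> V} := mmap (@idfun V) (fun _ => 0).
exists 0%N, f, (@mpolyC 0 V); split=> [p|a|a]; last 2 first.
- exact: mmapC.
- exact: mmapC.
apply: (@mpoly_rmorph_ext _ _ _ (@mpolyC 0 V \o f) idfun) => [a|[] //].
by rewrite /= /f mmapC.
Qed.

(** The outer variable corresponds to ['X_ord0], the earlier ones to the lifted indices; the two
    composites are compared on constants and variables. *)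
Lemma poly_algebraX (V R : comNzRingType) (kap : V -> R) :
  poly_algebra kap -> poly_algebra (fun a => (kap a)%:P).
Proof.
case=> n [f [g [fK gK fC]]].
pose C := (@mpolyC n.+1 V).
pose F : {rmorphism {mpoly V[n.+1]} -> {poly R}} :=
  mmap (polyC \o (f \o @mpolyC n V))
    (fun i => if unlift ord0 i is Some j then (f 'X_j)%:P else 'X).
pose W : {rmorphism {mpoly V[n]} -> {mpoly V[n.+1]}} := mmap C (fun i => 'X_(lift ord0 i)).
pose G : {rmorphism {poly R} -> {mpoly V[n.+1]}} :=
  horner_morph (fun a : R => mulrC 'X_ord0 ((W \o g) a)).
have FC a : F a%:MP = (kap a)%:P by rewrite /F /= mmapC /= fC.
have FX i : F 'X_i = if unlift ord0 i is Some j then (f 'X_j)%:P else 'X.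
  by rewrite /F /= mmapX mmap1U.
have WC a : W a%:MP = a%:MP by rewrite /W /= mmapC.
have WX i : W 'X_i = 'X_(lift ord0 i) by rewrite /W /= mmapX mmap1U.
have GC a : G a%:P = W (g a) by rewrite /G /= horner_morphC.
have GX : G 'X = 'X_ord0 by rewrite /G /= horner_morphX.
have FW p : F (W p) = (f p)%:P.
  apply: (@mpoly_rmorph_ext _ _ _ (F \o W) (polyC \o f)) => [a|i] /=.
    by rewrite WC FC fC.
  by rewrite WX FX liftK.
exists n.+1, F, G; split=> // p.
  apply: (@mpoly_rmorph_ext _ _ _ (G \o F) idfun) => [a|i] /=.
    by rewrite FC GC -fC fK WC.
  by rewrite FX; case: unliftP => [j ->|->]; rewrite ?GX // GC fK WX.
elim/poly_ind: p => [|p c IH]; first by rewrite !rmorph0.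
by rewrite !rmorphD !rmorphM IH GX GC FW gK FX unlift_none.
Qed.

(** * Valuation rings and localized regular sequences *)

Lemma horner_over (R : comNzRingType) (D : R -> Prop) (p : {poly R}) x :
  subring D -> poly_over D p -> D x -> D p.[x].
Proof.
move=> rD Dp Dx; rewrite horner_coef; apply: subring_sum => // i _.
by apply: subringM => //; apply: subringX.
Qed.

Section ValuationRing.
Variables (L : fieldType) (O : L -> Prop).
Hypothesis O_ring : subring O.
Hypothesis O_total : forall y, O y \/ O y^-1.

Definition unitO y := [/\ y != 0, O y & O y^-1].
Definition maxO y := O y /\ ~ unitO y.

Lemma unitO1 : unitO 1.
Proof. by split; rewrite ?oner_eq0 ?invr1 //; apply: subring1. Qed.

Lemma unitOM x y : unitO x -> unitO y -> unitO (x * y).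
Proof.
move=> [x0 Ox Oxi] [y0 Oy Oyi]; split; first by rewrite mulf_neq0.
  exact: subringM.
by rewrite invfM; apply: subringM.
Qed.

Lemma maxO0 : maxO 0.
Proof. by split; [apply: subring0 | case; rewrite eqxx]. Qed.

Lemma unit_or_maxO y : O y -> unitO y \/ maxO y.
Proof. by move=> Oy; case: (classic (unitO y)) => h; [left | right]. Qed.

Lemma maxOM x y : maxO x -> O y -> maxO (x * y).
Proof.
move=> [Ox nx] Oy; split; first exact: subringM.
move=> [xy0 _ Oxy]; apply: nx; move: xy0; rewrite mulf_eq0 negb_or => /andP[x0 y0].
split=> //; have -> : x^-1 = y * (x * y)^-1 by field; rewrite x0 y0.
exact: subringM.
Qed.

Lemma maxOMl x y : O x -> maxO y -> maxO (x * y).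
Proof. by move=> Ox my; rewrite mulrC; apply: maxOM. Qed.

Lemma not_O_maxOV y : ~ O y -> maxO y^-1.
Proof.
move=> nO; split; first by case: (O_total y).
by case; rewrite invrK.
Qed.

Lemma maxOD x y : maxO x -> maxO y -> maxO (x + y).
Proof.
have h a b : a != 0 -> O (b / a) -> maxO a -> maxO (a + b).
  move=> a0 Oba ma; have -> : a + b = a * (1 + b / a) by field.
  by apply: maxOM => //; apply: subringD => //; apply: subring1.
case: (eqVneq x 0) => [->|x0] mx my; first by rewrite add0r.
case: (eqVneq y 0) => [->|y0]; first by rewrite addr0.
case: (O_total (y / x)) => hO; first exact: h.
by rewrite addrC; apply: h => //; rewrite -invf_div.
Qed.

Lemma unitO_addM x y : unitO x -> maxO y -> unitO (x + y).
Proof.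
move=> ux my; case: (unit_or_maxO (y := x + y)) => // [|h].
  by apply: subringD => //; [case: ux | case: my].
case: (h) => _; case; case: (maxOD h (maxOMl (x := -1) _ my)).
  by apply: subringN => //; apply: subring1.
by rewrite mulN1r addrK.
Qed.

(** The hypothesis says that a y is a unit congruent to 1, a condition symmetric under inverting
    both elements. *)
Lemma approx_inv y a : y != 0 -> maxO ((y^-1 - a) / y^-1) ->
  a != 0 /\ maxO ((y - a^-1) / y).
Proof.
move=> y0 ma; have a0 : a != 0.
  apply/negP => /eqP a0; case: ma => _; apply; rewrite a0 subr0 divff ?invr_eq0 //.
  exact: unitO1.
have ua : unitO (a * y).
  have -> : a * y = 1 + (-1) * ((y^-1 - a) / y^-1).
    by rewrite mulrBl divff ?invr_eq0 // invrK; ring.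
  apply: unitO_addM => //; first exact: unitO1.
  by apply: maxOMl => //; apply: subringN => //; apply: subring1.
split=> //.
have -> : (y - a^-1) / y = (-1 * (a * y)^-1) * ((y^-1 - a) / y^-1).
  by rewrite !mulrBl !divff ?invr_eq0 // invrK invfM; field; rewrite a0 y0.
apply: maxOMl => //; apply: subringM => //; last by case: ua.
by apply: subringN => //; apply: subring1.
Qed.

End ValuationRing.

(** Here v = (a / b) d with d a unit of inverse c, so approximating d by r in the residue field
    approximates v by (a / b) r in relative terms. *)
Lemma approx_unit (L : fieldType) (v a b c d r : L) : a != 0 -> b != 0 ->
  b * v = a * d -> c * d = 1 -> (v - a / b * r) / v = c * (d - r).
Proof.
move=> a0 b0 e1 e2; have d0 : d != 0.
  by apply/negP => /eqP d0; move/eqP: e2; rewrite d0 mulr0 eq_sym oner_eq0.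
have -> : v = a / b * d by apply: (mulfI b0); rewrite e1; field.
have -> : c = d^-1 by apply: (mulIf d0); rewrite e2 mulVf.
by field; rewrite a0 b0 d0.
Qed.

Section LocalPoly.
Variables (R : comNzRingType) (S : R -> Prop).
Hypothesis S1 : S 1.
Hypothesis SM : forall s t, S s -> S t -> S (s * t).

(* I x holds in the localization at S *)
Definition sat (I : R -> Prop) (x : R) : Prop := exists s, S s /\ I (s * x).

Lemma sat_poly (I : R -> Prop) (q : {poly R}) : is_ideal I ->
  (forall k, sat I q`_k) -> exists t, S t /\ poly_over I (t%:P * q).
Proof.
move=> idI hq.
have [t [St ht]] : exists t, S t /\ forall k, (k < size q)%N -> I (t * q`_k).
  elim: (size q) => [|n [t [St ht]]]; first by exists 1.
  have [s [Ss hs]] := hq n; exists (s * t); split=> [|k]; first exact: SM.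
  rewrite ltnS leq_eqVlt => /orP[/eqP->|kn].
    by rewrite mulrAC; apply: (is_idealMr _ idI).
  by rewrite -mulrA; apply: (is_idealMl _ idI); apply: ht.
exists t; split=> // k; rewrite coefCM; case: (ltnP k (size q)) => kq; first exact: ht.
by rewrite nth_default // mulr0; apply: is_ideal0.
Qed.

(** Successive cancellation in the localization at [S], read in [R]; properness is established at
    the very end, from evaluation in a field. *)
Definition reg_seq (P : seq R) : Prop :=
  forall k x, (k < size P)%N ->
    sat (gen (take k P)) (x * P`_k) -> sat (gen (take k P)) x.

Lemma reg_seq_rcons P r : reg_seq P ->
  (forall x, sat (gen P) (x * r) -> sat (gen P) x) -> reg_seq (rcons P r).
Proof.
move=> hP hr k x; rewrite size_rcons ltnS leq_eqVlt => /orP[/eqP->|kP].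
  by rewrite -cats1 take_size_cat // nth_cat ltnn subnn /=; apply: hr.
by rewrite -cats1 takel_cat ?(ltnW kP) // nth_cat kP; apply: hP.
Qed.

End LocalPoly.

(** Cancellation is tested on each coefficient, and the finitely many denominators are multiplied
    together. *)
Lemma reg_seq_polyC (R : comNzRingType) (S : R -> Prop) (S' : {poly R} -> Prop) P :
  S 1 -> (forall s t, S s -> S t -> S (s * t)) ->
  (forall s t, S' s -> S' t -> S' (s * t)) -> (forall s, S s -> S' s%:P) ->
  reg_seq S P -> reg_seq S' (map polyC P).
Proof.
move=> S1 SM SM' SS' hP k x; rewrite size_map => kP [s [Ss]].
rewrite -map_take (nth_map 0) // mulrA => /gen_polyC hs.
have [t [St ht]] : exists t, S t /\ poly_over (gen (take k P)) (t%:P * (s * x)).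
  apply: sat_poly => //; first exact: gen_ideal.
  move=> i; apply: hP => //; exists 1; split=> //; rewrite mul1r.
  by move: (hs i); rewrite coefMC.
exists (t%:P * s); split; first by apply: SM' => //; apply: SS'.
by rewrite -mulrA; apply/gen_polyC.
Qed.

Lemma gen_rmorph0 (R R' : comNzRingType) (f : {rmorphism R -> R'}) P x :
  (forall p, p \in P -> f p = 0) -> gen P x -> f x = 0.
Proof.
move=> hP h; pattern x; apply: h => //; split=> // [|a b ha hb|a b _ hb].
- by rewrite rmorph0.
- by rewrite rmorphD ha hb addr0.
- by rewrite rmorphM hb mulr0.
Qed.

Lemma regular_var_iff (V : comNzRingType) (mV : V -> Prop) (R : comNzRingType)
    (S : R -> Prop) kap xi (I I' : R -> Prop) :
  (forall y, I y <-> I' y) -> regular_var mV S kap xi I -> regular_var mV S kap xi I'.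
Proof.
move=> h hI l l' hl'; have [y yl|D [F [J [h1 h2 h3 h4 h5]]]] := hI l l'.
  exact/h/hl'.
by exists D, F, J; split=> // y /h5/h.
Qed.

Lemma pseudo_div (R : comNzRingType) (D : R -> Prop) (p h : {poly R}) :
  subring D -> poly_over D p -> poly_over D h -> h != 0 ->
  exists k q r, [/\ poly_over D q, poly_over D r, (size r < size h)%N &
    (lead_coef h ^+ k)%:P * p = q * h + r].
Proof.
move=> rD Dp Dh h0; have rD' := poly_over_subring rD.
have [n] := ubnP (size p); elim: n p Dp => // n IH p Dp sp.
case: (ltnP (size p) (size h)) => hp.
  exists 0%N, 0, p; split=> //; first by move=> k; rewrite coef0; apply: subring0.
  by rewrite expr0; ring.
have sh : (0 < size h)%N by rewrite lt0n size_poly_eq0.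
have sp0 : (0 < size p)%N by apply: leq_trans hp.
pose m := (size p - size h)%N.
pose p' := (lead_coef h)%:P * p - (lead_coef p)%:P * 'X^m * h.
have DXm : poly_over D 'X^m by apply: (subringX rD'); apply: poly_overX.
have Dp' : poly_over D p'.
  by apply: (subringB rD'); repeat apply: (subringM rD') => //; apply: poly_overC => //;
    [apply: Dh | apply: Dp].
have sp' : (size p' < n)%N.
  suff : (size p' <= (size p).-1)%N by move/leq_ltn_trans; apply; rewrite prednK // -ltnS.
  apply/leq_sizeP => i hi; rewrite coefB coefCM -mulrA coefCM coefXnM.
  have -> : (i < m)%N = false.
    apply/negbTE; rewrite -leqNgt; apply: leq_trans hi.
    by rewrite /m -subn1; apply: leq_sub2l.
  move: hi; rewrite leq_eqVlt => /orP[/eqP<-|hi]; last first.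
    have ip : (size p <= i)%N by rewrite -(prednK sp0).
    rewrite [p`_i]nth_default // [h`_(i - m)]nth_default ?mulr0 ?subrr //.
    by rewrite leq_subRL ?(leq_trans (leq_subr _ _)) // subnK.
  have -> : ((size p).-1 - m)%N = (size h).-1 by rewrite /m -!subn1 subnAC subKn.
  by rewrite mulrC subrr.
have [k [q [r [Dq Dr sr e]]]] := IH p' Dp' sp'.
exists k.+1, (q + (lead_coef h ^+ k)%:P * ((lead_coef p)%:P * 'X^m)), r; split=> //.
  apply: (subringD rD') => //; apply: (subringM rD').
    by apply: poly_overC => //; apply: subringX => //; apply: Dh.
  by apply: (subringM rD') => //; apply: poly_overC => //; apply: Dp.
rewrite exprSr polyCM.
transitivity ((lead_coef h ^+ k)%:P * p' +
  (lead_coef h ^+ k)%:P * ((lead_coef p)%:P * 'X^m) * h); first by rewrite /p'; ring.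
by rewrite e; ring.
Qed.

(** * Towers *)

(** Each factor e turns one X into G modulo e X - G, so a power of e reduces any polynomial to a
    constant. *)
Lemma linear_reduce (R : comNzRingType) (e G : R) (f : {poly R}) :
  exists n f0 q, (e ^+ n)%:P * f = f0%:P + (e%:P * 'X - G%:P) * q.
Proof.
elim/poly_ind: f => [|p b [n [f0 [q IH]]]].
  by exists 0%N, 0, 0; rewrite polyC0; ring.
exists n.+1, (G * f0 + e ^+ n.+1 * b), (f0%:P + e%:P * q * 'X).
rewrite exprSr polyCD !polyCM.
transitivity (e%:P * 'X * ((e ^+ n)%:P * p) + (e ^+ n)%:P * e%:P * b%:P); first by ring.
by rewrite IH; ring.
Qed.

(** * Presented subalgebras of the valuation ring O that fix given elements *)

Section Immediate.
Variables (k : fieldType) (V : comNzRingType) (L : fieldType) (O : L -> Prop).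
Variables (ik : {rmorphism k -> V}) (j : {rmorphism V -> L}).

Definition in_frac (y : L) : Prop := exists a b, j b != 0 /\ y = j a / j b.

Definition subfield (K : L -> Prop) : Prop :=
  [/\ subring K, forall y, K y -> K y^-1 & forall y, in_frac y -> K y].

Hypothesis O_ring : subring O.
Hypothesis O_total : forall y, O y \/ O y^-1.
Hypothesis j_inj : forall a, j a = 0 -> a = 0.
Hypothesis jO : forall a, O (j a).
Hypothesis O_frac : forall y, in_frac y -> O y -> exists a, j a = y.
(** Equality of value groups and of residue fields in one condition: y differs from an element of
    Frac V by a factor congruent to 1. *)
Hypothesis immediate : forall y, y != 0 -> exists a, in_frac a /\ maxO O ((y - a) / y).

Let mV (b : V) : Prop := maxO O (j b).

Lemma frac_subfield : subfield in_frac.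
Proof.
split=> //; first split.
- by exists 1, 1; rewrite rmorph1 oner_eq0 divr1.
- move=> _ _ [a [b [b0 ->]]] [c [d [d0 ->]]]; exists (a * d - c * b), (b * d).
  rewrite !rmorphB !rmorphM mulf_neq0 //; split=> //; field; exact/andP.
- move=> _ _ [a [b [b0 ->]]] [c [d [d0 ->]]]; exists (a * c), (b * d).
  rewrite !rmorphM mulf_neq0 //; split=> //; field; exact/andP.
- move=> _ [a [b [b0 ->]]]; case: (eqVneq (j a) 0) => a0.
    by exists 0, 1; rewrite rmorph1 oner_eq0 rmorph0 a0 !mul0r invr0.
  by exists b, a; split=> //; rewrite invf_div.
Qed.

Lemma frac_j a : in_frac (j a).
Proof. by exists a, 1; rewrite rmorph1 oner_eq0 divr1. Qed.

Lemma fracM x y : in_frac x -> in_frac y -> in_frac (x * y).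
Proof. by case: frac_subfield => rf _ _; apply: subringM. Qed.

Lemma fracV x : in_frac x -> in_frac x^-1.
Proof. by case: frac_subfield => _ h _; apply: h. Qed.

Lemma frac_div x y : in_frac x -> in_frac y -> in_frac (x / y).
Proof. by move=> fx fy; apply: fracM => //; apply: fracV. Qed.

Lemma mVM a b : mV b -> mV (b * a).
Proof. by move=> mb; rewrite /mV rmorphM; apply: maxOM. Qed.

(* Stands for the subalgebra of L consisting of the fractions f / s of values of
   prs_eval with s of value a unit of O. *)
Record presentation := Presentation {
  prs_ring : comNzRingType;
  prs_const : {rmorphism V -> prs_ring};
  prs_eval : {rmorphism prs_ring -> L};
  prs_rels : seq prs_ring }.

Definition prs_unit p (s : prs_ring p) : Prop := unitO O (prs_eval p s).

(** The last three clauses make the localized algebra a complete intersection: regular relations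
    that generate the whole kernel of evaluation. *)
Record presents (K : L -> Prop) (p : presentation) : Prop := Presents {
  prs_alg : poly_algebra (prs_const p);
  prs_evalC : forall a, prs_eval p (prs_const p a) = j a;
  prs_O : forall f, O (prs_eval p f);
  prs_K : forall f, K (prs_eval p f);
  prs_reg : reg_seq (@prs_unit p) (prs_rels p);
  prs_ker : forall f, prs_eval p f = 0 -> sat (@prs_unit p) (gen (prs_rels p)) f;
  prs_rels0 : forall f, f \in prs_rels p -> prs_eval p f = 0 }.

(** The equation y = a (u / s) with the denominator cleared, [u / s] being a unit of the localized
    algebra. *)
Definition prs_fixed p (y : L) : Prop := exists a s u,
  [/\ in_frac a /\ a != 0, prs_unit s, @prs_unit p u & prs_eval p s * y = a * prs_eval p u].

Definition fixable (K : L -> Prop) : Prop := forall E : seq L,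
  (forall y, y \in E -> K y /\ y != 0) ->
  exists p, presents K p /\ forall y, y \in E -> prs_fixed p y.

(** [V] itself serves, with no variables and no relations. *)
Lemma fixable_frac : fixable in_frac.
Proof.
move=> E hE; exists (@Presentation V idfun j [::]); split.
  split=> //=; [exact: poly_algebra0 | exact: frac_j |].
  move=> f /j_inj ->; exists 1; split; last by rewrite mulr0; apply: is_ideal0 (gen_ideal _).
  by rewrite /prs_unit /= rmorph1; apply: unitO1.
move=> y /hE[Ky y0]; exists y, 1, 1; rewrite /prs_unit /= rmorph1 mul1r mulr1.
by split=> //; apply: unitO1.
Qed.

(** * Towers of variables over an intermediate field K *)

Section Tower.
Variables (K : L -> Prop) (x : L).
Hypothesis K_field : subfield K.
Hypothesis x_max : maxO O x.

(* A presentation over tw_base of a subring of L[X] localized at the elements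
   whose value at x is a unit; tw_var is the last variable adjoined. *)
Record tower := Tower {
  tw_base : presentation;
  tw_ring : comNzRingType;
  tw_in : {rmorphism prs_ring tw_base -> tw_ring};
  tw_poly : {rmorphism tw_ring -> {poly L}};
  tw_var : tw_ring;
  tw_rels : seq tw_ring }.

Definition tw_const t : {rmorphism V -> tw_ring t} := tw_in t \o prs_const (tw_base t).
Definition tw_eval t (f : tw_ring t) : L := (tw_poly t f).[x].
Definition tw_unit t (s : tw_ring t) : Prop := unitO O (tw_eval s).

(** [tw_regular] includes a base element [d] among the relations in order to exclude torsion over
    the base. [tw_elim] undoes the divisions made when adjoining variables: every element is a
    quotient of polynomials in x over the base, with denominator a unit times a constant of [V]. *)
Record good_tower (t : tower) : Prop := GoodTower {
  tw_base_good : presents K (tw_base t);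
  tw_alg : poly_algebra (tw_const t);
  tw_polyC : forall b, tw_poly t (tw_in t b) = (prs_eval (tw_base t) b)%:P;
  tw_O : forall f : tw_ring t, O (tw_eval f);
  tw_K : forall f, poly_over K (tw_poly t f);
  tw_var_max : maxO O (tw_eval (tw_var t));
  tw_reg : reg_seq (@tw_unit t) (tw_rels t);
  tw_ker : forall f, tw_poly t f = 0 -> sat (@tw_unit t) (gen (tw_rels t)) f;
  tw_rels0 : forall f, f \in tw_rels t -> tw_poly t f = 0;
  tw_regular : forall d, regular_var mV (@tw_unit t) (tw_const t) (tw_var t)
                           (gen (tw_in t d :: tw_rels t));
  tw_gen : exists z, tw_poly t z = 'X;
  tw_elim : forall f, exists s c f1 f2, [/\ tw_unit s, j c != 0,
    tw_poly t (s * tw_const t c) = map_poly (prs_eval (tw_base t)) f2 &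
    tw_poly t (s * tw_const t c * f) = map_poly (prs_eval (tw_base t)) f1] }.

Definition tw_fixed t (f : {poly L}) : Prop := exists a s u,
  [/\ in_frac a /\ a != 0, tw_unit s, @tw_unit t u & tw_poly t s * f = a *: tw_poly t u].

(* Tame polynomials are those that may serve as the right-hand side of the next
   relation. *)
Definition tw_tame t (f : {poly L}) : Prop := exists a s G,
  [/\ in_frac a /\ a != 0, @tw_unit t s,
      regular_elt mV (@tw_unit t) (tw_const t) (tw_var t) G
    & tw_poly t s * f = a *: tw_poly t G].

Section TowerUnits.
Variable t : tower.

Lemma tw_evalM (f g : tw_ring t) : tw_eval (f * g) = tw_eval f * tw_eval g.
Proof. by rewrite /tw_eval rmorphM hornerM. Qed.

Lemma tw_evalD (f g : tw_ring t) : tw_eval (f + g) = tw_eval f + tw_eval g.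
Proof. by rewrite /tw_eval rmorphD hornerD. Qed.

Lemma tw_unit1 : @tw_unit t 1.
Proof. by rewrite /tw_unit /tw_eval rmorph1 hornerC; apply: unitO1. Qed.

Lemma tw_unitM (f g : tw_ring t) : tw_unit f -> tw_unit g -> tw_unit (f * g).
Proof. by rewrite /tw_unit tw_evalM; apply: unitOM. Qed.

Lemma tw_unit_neq0 (s : tw_ring t) : tw_unit s -> tw_poly t s != 0.
Proof. by case=> h _ _; apply: contraNneq h => e; rewrite /tw_eval e horner0. Qed.

Hypothesis gt : good_tower t.

Lemma tw_polyconst a : tw_poly t (tw_const t a) = (j a)%:P.
Proof. by rewrite /tw_const (tw_polyC gt) (prs_evalC (tw_base_good gt)). Qed.

Lemma tw_evalC a : tw_eval (tw_const t a) = j a.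
Proof. by rewrite /tw_eval tw_polyconst hornerC. Qed.

Lemma tw_unitD (s g : tw_ring t) : tw_unit s -> maxO O (tw_eval g) -> tw_unit (s + g).
Proof. by rewrite /tw_unit tw_evalD; apply: unitO_addM. Qed.

Lemma tw_unit_mV (s : tw_ring t) b y : tw_unit s -> mV b -> tw_unit (s + tw_const t b * y).
Proof.
move=> us mb; apply: tw_unitD => //.
by rewrite tw_evalM tw_evalC; apply: maxOM => //; apply: tw_O.
Qed.

End TowerUnits.

Definition base_tower (p : presentation) : tower :=
  @Tower p {poly prs_ring p} polyC (map_poly (prs_eval p)) 'X (map polyC (prs_rels p)).

Lemma good_base_tower p : presents K p -> good_tower (base_tower p).
Proof.
case=> alg evC pO pK reg ker rel0.
have K_ring : subring K by case: K_field.
have Sc (s : prs_ring p) : prs_unit s -> @tw_unit (base_tower p) s%:P.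
  by rewrite /tw_unit /tw_eval /= map_polyC hornerC.
have S1 : @prs_unit p 1 by rewrite /prs_unit rmorph1; apply: unitO1.
have SM (s u : prs_ring p) : prs_unit s -> prs_unit u -> prs_unit (s * u).
  by rewrite /prs_unit rmorphM; apply: unitOM.
split=> //=.
- exact: (poly_algebraX alg).
- by move=> b; rewrite map_polyC.
- move=> f; apply: horner_over => //; last by case: x_max.
  by move=> i; rewrite coef_map; apply: pO.
- by move=> f i; rewrite coef_map; apply: pK.
- by rewrite /tw_eval /= map_polyX hornerX.
- exact: (reg_seq_polyC (S' := @tw_unit (base_tower p)) S1 SM (@tw_unitM (base_tower p)) Sc reg).
- move=> f f0.
  have [u [Su hu]] : exists u, prs_unit u /\ poly_over (gen (prs_rels p)) (u%:P * f).
    apply: sat_poly => //; first exact: gen_ideal.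
    by move=> i; apply: ker; rewrite -coef_map f0 coef0.
  by exists u%:P; split; [apply: Sc | apply/gen_polyC].
- by move=> _ /mapP[f fp ->]; rewrite map_polyC /= rel0.
- move=> d; apply: (regular_var_iff (I := poly_over (gen (d :: prs_rels p)))).
    by move=> y; rewrite -gen_polyC.
  apply: (regular_var_base mV (prs_const p \o ik) (prs_const p) (S := @tw_unit (base_tower p))) => [|].
    exact: tw_unit1.
  exact: gen_ideal.
- by exists 'X; rewrite map_polyX.
- move=> f; exists 1, 1, f, 1; split; first exact: tw_unit1.
  + by rewrite rmorph1 oner_eq0.
  + by rewrite !rmorph1 !mul1r rmorph1.
  + by rewrite !rmorph1 !mul1r.
Qed.

(** * Adjoining the variable Z = Q(x) / c to a tower *)

Section Link.
Variables (t : tower) (Q : {poly L}) (c a : L) (s G : tw_ring t) (d : V).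
Hypothesis gt : good_tower t.
Hypothesis Q_over : poly_over K Q.
Hypothesis c_frac : in_frac c.
Hypothesis c0 : c != 0.
Hypothesis a0 : a != 0.
Hypothesis Qx : maxO O (Q.[x] / c).
Hypothesis us : tw_unit s.
Hypothesis regG : regular_elt mV (@tw_unit t) (tw_const t) (tw_var t) G.
Hypothesis eQ : tw_poly t s * Q = a *: tw_poly t G.
Hypothesis jd : j d = c / a.

(** With Q = c Z and d = c / a, the equation s Q = a G becomes (s d) Z = G. *)
Let e : tw_ring t := s * tw_const t d.
Let r : {poly tw_ring t} := e%:P * 'X - G%:P.

Definition link_poly : {rmorphism {poly tw_ring t} -> {poly L}} :=
  horner_morph (fun f => mulrC (c^-1 *: Q) (tw_poly t f)).

Definition link_tower : tower :=
  @Tower (tw_base t) {poly tw_ring t} (polyC \o tw_in t) link_poly 'X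
    (rcons (map polyC (tw_rels t)) r).

Let t' := link_tower.

Lemma link_polyC f : link_poly f%:P = tw_poly t f.
Proof. by rewrite /link_poly /= horner_morphC. Qed.

Lemma link_polyX : link_poly 'X = c^-1 *: Q.
Proof. by rewrite /link_poly /= horner_morphX. Qed.

Lemma link_unitC f : tw_unit f -> @tw_unit t' f%:P.
Proof. by rewrite /tw_unit /tw_eval /= link_polyC. Qed.

Lemma j_d0 : j d != 0.
Proof. by rewrite jd mulf_neq0 ?invr_eq0. Qed.

Lemma link_e : tw_poly t e * (c^-1 *: Q) = tw_poly t G.
Proof.
rewrite rmorphM (tw_polyconst gt) jd -mul_polyC.
transitivity ((c / a)%:P * (c^-1)%:P * (tw_poly t s * Q)); first by ring.
rewrite eQ -mul_polyC mulrA -!polyCM; have -> : c / a / c * a = 1 by field; exact/andP.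
by rewrite mul1r.
Qed.

Lemma link_rel0 : link_poly r = 0.
Proof.
by rewrite rmorphB rmorphM link_polyX !link_polyC link_e subrr.
Qed.

Lemma link_evalC f : tw_eval (t := t') f%:P = tw_eval f.
Proof. by rewrite /tw_eval /= link_polyC. Qed.

Lemma link_evalX : tw_eval (t := t') 'X = Q.[x] / c.
Proof. by rewrite /tw_eval /= link_polyX hornerZ mulrC. Qed.

Let unit'M := @tw_unitM t'.

Lemma link_unit_e0 : tw_poly t e != 0.
Proof.
rewrite rmorphM (tw_polyconst gt) mulf_neq0 ?polyC_eq0 ?j_d0 //.
exact: tw_unit_neq0 us.
Qed.

Lemma link_reduce (f : {poly tw_ring t}) :
  exists n f0 q, (e ^+ n)%:P * f = f0%:P + r * q.
Proof. exact: linear_reduce. Qed.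

Let Pc := map polyC (tw_rels t).

Lemma sat_ker (q : {poly tw_ring t}) : (forall i, tw_poly t q`_i = 0) ->
  exists u, tw_unit u /\ gen Pc (u%:P * q).
Proof.
move=> hq; have [u [uu hu]] : exists u, @tw_unit t u /\ poly_over (gen (tw_rels t)) (u%:P * q).
  apply: sat_poly; [exact: tw_unit1 | exact: tw_unitM | exact: gen_ideal |].
  by move=> i; apply: tw_ker.
by exists u; split=> //; apply/gen_polyC.
Qed.

Lemma gen_Pc0 (q : {poly tw_ring t}) i : gen Pc q -> tw_poly t q`_i = 0.
Proof. by move/gen_polyC => /(_ i); apply: gen_rmorph0; apply: tw_rels0. Qed.

Lemma nzd_G b (y : tw_ring t) :
  gen (tw_in t b :: tw_rels t) (G * y) -> sat (@tw_unit t) (gen (tw_in t b :: tw_rels t)) y.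
Proof.
apply: (regular_elt_nzd mVM (S := @tw_unit t) (kap := tw_const t) (xi := tw_var t)) => //.
- exact: tw_unit1.
- exact: tw_unitM.
- by move=> *; apply: tw_unit_mV.
- exact: tw_regular.
Qed.

Lemma link_rels_rcons (y : {poly tw_ring t}) :
  gen (tw_rels t') y <-> exists y1 q, gen Pc y1 /\ y = y1 + q * r.
Proof. exact: gen_rcons. Qed.

(* Modulo b, the relation e X - G is a non-zero-divisor since its constant
   coefficient - G is one. *)
Lemma link_torsion b (y : {poly tw_ring t}) : j b != 0 ->
  gen (tw_rels t') ((tw_const t b)%:P * y) -> sat (@tw_unit t') (gen (tw_rels t')) y.
Proof.
move=> jb /link_rels_rcons[y1 [q [hy1 ey]]].
pose I := gen (tw_in t (prs_const (tw_base t) b) :: tw_rels t).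
have idI : is_ideal I := gen_ideal _.
have hr i : I (q * r)`_i.
  have -> : q * r = (tw_const t b)%:P * y - y1 by rewrite ey addrC addKr.
  rewrite coefB coefCM; apply: (is_idealB idI).
    by apply: (is_idealMr _ idI); apply: gen_mem; rewrite inE eqxx.
  move/gen_polyC: hy1 => /(_ i); apply: gen_subset => p pP.
  by rewrite inE pP orbT.
have cr0 : (q * r)`_0 = - (q`_0 * G).
  by rewrite /r mulrBr mulrA coefB coefMX eqxx coefMC sub0r.
have crS i : (q * r)`_i.+1 = q`_i * e - q`_i.+1 * G.
  by rewrite /r mulrBr mulrA coefB coefMX /= !coefMC.
(* By induction on the degree: the constant coefficient of q r is - q_0 G, the next ones are q_i e -
   q_(i+1) G, and [G] cancels modulo the relations and b. *)
have hq i : sat (@tw_unit t) I q`_i.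
  elim: i => [|i [u [uu hu]]].
    apply: nzd_G; have := is_idealN idI (hr 0%N).
    by rewrite cr0 opprK mulrC.
  have [|u' [uu' hu']] := nzd_G (b := prs_const (tw_base t) b) (y := u * q`_i.+1).
    have -> : G * (u * q`_i.+1) = e * (u * q`_i) - u * (q * r)`_i.+1.
      by rewrite crS; ring.
    by apply: (is_idealB idI); apply: (is_idealMl _ idI).
  by exists (u' * u); rewrite -mulrA; split=> //; apply: tw_unitM.
have [u [uu hu]] := sat_poly (@tw_unit1 t) (@tw_unitM t) idI hq.
(* Up to a unit, q = q1 + b q2 with q1 in the old relations. Then b (u y - r q2) is in the old
   relations as well, and b cancels after mapping to L[X]. *)
have /gen_cons[q1 [q2 [hq1 eq]]] : gen ((tw_const t b)%:P :: Pc) (u%:P * q).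
  by apply/(gen_polyC (tw_const t b :: tw_rels t)).
have [i|v [uv hv]] := @sat_ker (u%:P * y - r * q2).
  have : tw_poly t ((tw_const t b)%:P * (u%:P * y - r * q2))`_i = 0.
    apply: gen_Pc0; have -> : (tw_const t b)%:P * (u%:P * y - r * q2) = u%:P * y1 + r * q1.
      rewrite mulrBr mulrCA ey mulrDr [u%:P * (q * r)]mulrA eq; ring.
    have idP := gen_ideal Pc.
    by apply: (is_idealD idP); apply: (is_idealMl _ idP).
  rewrite coefCM rmorphM (tw_polyconst gt) => /eqP; rewrite mulf_eq0 polyC_eq0 (negPf jb).
  by move/eqP.
exists (v * u)%:P; split; first by apply: link_unitC; apply: tw_unitM.
apply/link_rels_rcons; exists (v%:P * (u%:P * y - r * q2)), (v%:P * q2); split=> //.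
rewrite polyCM; ring.
Qed.

Lemma good_link_tower : good_tower t'.
Proof.
have [K_ring KV Kfrac] := K_field.
split=> /=.
- exact: tw_base_good.
- exact: (poly_algebraX (tw_alg gt)).
- by move=> b; rewrite horner_morphC; apply: (tw_polyC gt).
- elim/poly_ind => [|p b IH]; first by rewrite /tw_eval rmorph0 horner0; apply: subring0.
  rewrite tw_evalD tw_evalM link_evalX link_evalC; apply: subringD => //; last exact: tw_O.
  by apply: subringM => //; case: Qx.
- elim/poly_ind => [|p b IH]; first by rewrite rmorph0 => i; rewrite coef0; apply: subring0.
  have pK := poly_over_subring K_ring.
  rewrite rmorphD rmorphM link_polyC; apply: (subringD pK); last exact: tw_K.
  apply: (subringM pK) => //; rewrite link_polyX -mul_polyC; apply: (subringM pK) => //.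
  by apply: poly_overC => //; apply/KV/Kfrac.
- by rewrite link_evalX.
- apply: reg_seq_rcons.
    exact: (reg_seq_polyC (@tw_unit1 t) (@tw_unitM t) unit'M link_unitC (tw_reg gt)).
  (* The relation r is cancelled in polynomials over the domain L[X], where its image is nonzero
     because its coefficient e is. *)
  move=> y [u [uu hu]]; have [i|v [uv hv]] := @sat_ker (u * y).
    have : map_poly (tw_poly t) (u * y) * map_poly (tw_poly t) r = 0.
      by rewrite -rmorphM -mulrA; apply/polyP => m; rewrite coef_map coef0; apply: gen_Pc0.
    move/eqP; rewrite mulf_eq0 => /orP[/eqP h|/eqP h].
      by move/(congr1 (fun p : {poly {poly L}} => p`_i)): h; rewrite coef_map coef0.
    move/(congr1 (fun p : {poly {poly L}} => p`_1)): h.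
    rewrite coef_map coef0 coefB coefMX coefC /= coefC subr0 => h.
    by have := link_unit_e0; rewrite h eqxx.
  exists (v%:P * u); split; last by rewrite -mulrA.
  by apply: unit'M => //; apply: link_unitC.
(* Some e^n f reduces to an element f1 of the old tower, where the kernel is known. Since e is a
   unit times d, this settles d^n f, and torsion-freeness removes d^n. *)
- move=> f f0; have {}f0 : link_poly f = 0 by exact: f0.
  have [n [f1 [q ef]]] := link_reduce f.
  have f10 : tw_poly t f1 = 0.
    have := congr1 link_poly ef.
    by rewrite rmorphD !rmorphM f0 mulr0 link_polyC link_rel0 mul0r addr0.
  have [u [uu hu]] := tw_ker gt f10.
  have [||v [uv hv]] := @link_torsion (d ^+ n) ((u * s ^+ n)%:P * f).
  - by rewrite rmorphXn expf_neq0 // j_d0.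
  - have -> : (tw_const t (d ^+ n))%:P * ((u * s ^+ n)%:P * f) = (u * f1)%:P + (u%:P * q) * r.
      rewrite rmorphXn !polyCM mulrA mulrAC -mulrA -[RHS]addrC.
      transitivity (u%:P * ((e ^+ n)%:P * f)); first by rewrite exprMn polyCM; ring.
      by rewrite ef; ring.
    apply/link_rels_rcons; exists (u * f1)%:P, (u%:P * q); split=> //.
    by apply/gen_polyC => i; rewrite coefC; case: ifP => // _; apply: is_ideal0 (gen_ideal _).
  exists (v * (u * s ^+ n)%:P); split; last by rewrite -mulrA.
  apply: unit'M => //; apply: link_unitC; apply: tw_unitM => //.
  by apply: SX => //; [apply: tw_unit1 | apply: tw_unitM].
- move=> f; rewrite mem_rcons inE => /orP[/eqP->|/mapP[p pP ->]]; first exact: link_rel0.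
  by rewrite link_polyC; apply: tw_rels0.
- move=> b; apply: (regular_var_iff (I := link_ideal (gen (tw_in t b :: tw_rels t)) e G)).
    move=> y; split=> [[y1 [q [hy1 ->]]]|].
      have idP := gen_ideal ((tw_in t b)%:P :: rcons Pc r).
      apply: (is_idealD idP); last first.
        by apply: (is_idealMr _ idP); apply: gen_mem; rewrite inE mem_rcons inE eqxx orbT.
      move/(gen_polyC (tw_in t b :: tw_rels t)): hy1; apply: gen_subset => p /=.
      by rewrite !inE mem_rcons inE => /orP[->|->]; rewrite ?orbT.
    move=> h; have /gen_rcons[y1 [q [hy1 ->]]] : gen (rcons ((tw_in t b)%:P :: Pc) r) y by [].
    exists y1, q; rewrite [q * _]mulrC; split=> //.
    exact/(gen_polyC (tw_in t b :: tw_rels t)).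
  have unit_mV u z y : tw_unit u -> mV z -> tw_unit (u + tw_const t z * y) by apply: tw_unit_mV.
  exact (regular_var_link mVM (@tw_unit1 t) (@tw_unitM t) unit_mV (S' := @tw_unit t') link_unitC
    (@tw_regular t gt b) regG).
- by have [z ez] := tw_gen gt; exists z%:P; rewrite horner_morphC.
(* Elimination is applied to both f0 and e^n, and f is recovered as their quotient modulo r. *)
- move=> f; have [n [f0 [q ef]]] := link_reduce f.
  have [s0 [c0' [f1 [f2 [us0 jc0 e2 e1]]]]] := tw_elim gt f0.
  have [s3 [c3 [g1 [g2 [us3 jc3 e4 e3]]]]] := tw_elim gt (e ^+ n).
  have eE : e ^+ n = s ^+ n * tw_const t (d ^+ n) by rewrite exprMn rmorphXn.
  exists (s0 * s3 * s ^+ n)%:P, (c0' * c3 * d ^+ n), (f1 * g2), (f2 * g1).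
  have -> : (s0 * s3 * s ^+ n)%:P * tw_const t' (c0' * c3 * d ^+ n) =
      (s0 * tw_const t c0' * (s3 * tw_const t c3 * e ^+ n))%:P.
    rewrite eE -[tw_const t' _]/((tw_const t _)%:P) !rmorphM; ring.
  split.
  + apply: link_unitC; apply: tw_unitM; first exact: tw_unitM.
    by apply: SX => //; [apply: tw_unit1 | apply: tw_unitM].
  + by rewrite !rmorphM rmorphXn !mulf_neq0 ?expf_neq0 // j_d0.
  + by rewrite [LHS]link_polyC [LHS]rmorphM e2 e3 [RHS]rmorphM.
  + have -> : (s0 * tw_const t c0' * (s3 * tw_const t c3 * e ^+ n))%:P * f =
        (s0 * tw_const t c0')%:P * (s3 * tw_const t c3)%:P * ((e ^+ n)%:P * f).
      by rewrite !polyCM; ring.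
    rewrite ef [LHS]rmorphM rmorphD [link_poly (r * _)]rmorphM link_rel0 mul0r addr0.
    rewrite [link_poly (_ * _)]rmorphM !link_polyC e4 mulrAC -[tw_poly t _ * tw_poly t f0]rmorphM e1.
    by rewrite [RHS]rmorphM.
Qed.

Lemma link_fixed f : tw_fixed t f -> tw_fixed t' f.
Proof.
move=> [a1 [s1 [u1 [fa us1 uu1 e1]]]]; exists a1, s1%:P, u1%:P.
by split=> //; rewrite ?[tw_poly t' _]link_polyC //; apply: link_unitC.
Qed.

End Link.

(** * Fixed and tame polynomials *)

Section FixedTame.
Variable t : tower.
Hypothesis gt : good_tower t.

Lemma frac_V y : in_frac y -> O y -> exists d, tw_poly t (tw_const t d) = y%:P /\ j d = y.
Proof. by move=> fy Oy; have [d <-] := O_frac fy Oy; exists d; rewrite tw_polyconst. Qed.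

Lemma unit_regular (u : tw_ring t) : tw_unit u ->
  regular_elt mV (@tw_unit t) (tw_const t) (tw_var t) u.
Proof.
move=> uu; exists 0, 0, 0%N, u; split=> //; last by rewrite mulr0 add0r expr0 mul1r.
by rewrite /mV rmorph0; apply: maxO0.
Qed.

Lemma regular_mul (u G : tw_ring t) : tw_unit u ->
  regular_elt mV (@tw_unit t) (tw_const t) (tw_var t) G ->
  regular_elt mV (@tw_unit t) (tw_const t) (tw_var t) (u * tw_var t * G).
Proof.
move=> uu [b [h [l [v [mb uv ->]]]]]; exists b, (u * tw_var t * h), l.+1, (u * v).
by split=> //; [apply: tw_unitM | rewrite exprS; ring].
Qed.

(** Of d and b, one divides the other in [V], so the two terms with coefficients in the maximal
    ideal merge into one. *)
Lemma regular_add d (y G : tw_ring t) : mV d ->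
  regular_elt mV (@tw_unit t) (tw_const t) (tw_var t) G ->
  regular_elt mV (@tw_unit t) (tw_const t) (tw_var t) (tw_const t d * y + G).
Proof.
move=> md [b [h [l [v [mb uv ->]]]]].
case: (eqVneq (j d) 0) => [/j_inj->|d0].
  by exists b, h, l, v; rewrite rmorph0 mul0r add0r.
case: (eqVneq (j b) 0) => [/j_inj->|b0].
  by exists d, y, l, v; rewrite rmorph0 mul0r add0r.
case: (O_total (j b / j d)) => hO.
  have [e je] := O_frac (frac_div (frac_j b) (frac_j d)) hO.
  have eb : b = d * e.
    by apply/eqP; rewrite -subr_eq0; apply/eqP/j_inj; rewrite rmorphB rmorphM je mulrC divfK ?subrr.
  exists d, (y + tw_const t e * h), l, v; split=> //.
  by rewrite eb rmorphM; ring.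
rewrite invf_div in hO.
have [e je] := O_frac (frac_div (frac_j d) (frac_j b)) hO.
have ed : d = b * e.
  by apply/eqP; rewrite -subr_eq0; apply/eqP/j_inj; rewrite rmorphB rmorphM je mulrC divfK ?subrr.
exists b, (tw_const t e * y + h), l, v; split=> //.
by rewrite ed rmorphM; ring.
Qed.

Lemma fixed_tame f : tw_fixed t f -> tw_tame t f.
Proof.
move=> [a [s [u [fa us uu e]]]]; exists a, s, u; split=> //; exact: unit_regular.
Qed.

(* The G of f0 + Q f1 is governed by whichever of the two summands has the
   smaller value; f0 contributes to the constant coefficient only. *)
Lemma tame_digit c Q f0 f1 : in_frac c -> c != 0 -> tw_poly t (tw_var t) = c^-1 *: Q ->
  f0 = 0 \/ tw_fixed t f0 -> f1 = 0 \/ tw_tame t f1 -> f0 + Q * f1 != 0 ->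
  tw_tame t (f0 + Q * f1).
Proof.
move=> fc c0 eQ; have {}eQ : Q = c *: tw_poly t (tw_var t).
  by rewrite eQ scalerA divff // scale1r.
case=> [->|[a0 [s0 [u0 [[fa0 a00] us0 uu0 e0]]]]]; case=> [->|[a1 [s1 [G [[fa1 a10] us1 rG e1]]]]].
- by rewrite mulr0 addr0 eqxx.
- move=> _; rewrite add0r; exists (a1 * c), s1, (1 * tw_var t * G); split=> //.
  + by rewrite mulf_neq0 //; split=> //; apply: fracM.
  + by apply: regular_mul => //; apply: tw_unit1.
  + rewrite mulrCA e1 eQ mul1r rmorphM -!mul_polyC polyCM; ring.
- by move=> _; rewrite mulr0 addr0; apply: fixed_tame; exists a0, s0, u0.
move=> _; have eq : tw_poly t (s0 * s1) * (f0 + Q * f1) =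
    a0 *: tw_poly t (s1 * u0) + (a1 * c) *: tw_poly t (s0 * tw_var t * G).
  rewrite !rmorphM eQ -!mul_polyC polyCM.
  transitivity (tw_poly t s1 * (tw_poly t s0 * f0) +
      c%:P * tw_poly t s0 * tw_poly t (tw_var t) * (tw_poly t s1 * f1)); first by ring.
  by rewrite e0 e1 -!mul_polyC; ring.
have a1c0 : a1 * c != 0 by rewrite mulf_neq0.
have fa1c : in_frac (a1 * c) by apply: fracM.
have us : tw_unit (s0 * s1) by apply: tw_unitM.
case: (classic (O (a1 * c / a0))) => hO.
  have [d [pd jd]] := frac_V (frac_div fa1c fa0) hO.
  exists a0, (s0 * s1), (s1 * u0 + tw_const t d * (s0 * tw_var t * G)); split=> //.
    apply: unit_regular; apply: tw_unitD; first exact: tw_unitM.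
    rewrite !tw_evalM; apply: maxOMl => //; first exact: tw_O.
    by apply: maxOM => //; [apply: maxOMl => //; [apply: tw_O|apply: tw_var_max] | apply: tw_O].
  rewrite eq rmorphD scalerDr [tw_poly t (tw_const t d * _)]rmorphM pd mul_polyC scalerA.
  by rewrite mulrCA divff // mulr1.
have mO := not_O_maxOV O_total hO; rewrite invf_div in mO.
have [d [pd jd]] := frac_V (frac_div fa0 fa1c) (proj1 mO).
exists (a1 * c), (s0 * s1), (tw_const t d * (s1 * u0) + s0 * tw_var t * G); split=> //.
  by apply: regular_add; [rewrite /mV jd | apply: regular_mul].
rewrite eq rmorphD scalerDr [tw_poly t (tw_const t d * _)]rmorphM pd mul_polyC scalerA.
by rewrite [a1 * c * _]mulrCA divff // mulr1.
Qed.

Lemma fixed_eval_neq0 f : tw_fixed t f -> f.[x] != 0.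
Proof.
move=> [a [s [u [[fa a0] us [u0 _ _] e]]]].
have := congr1 (horner^~ x) e; rewrite /= hornerM hornerZ -!/(tw_eval _) => e'.
by apply: contraNneq u0 => f0; move: e'; rewrite f0 mulr0 => /esym/eqP; rewrite mulf_eq0 (negPf a0).
Qed.

(** With r = a u / s and g = b v / w, the sum is a / (s w) times w u + (b / a) s v. The first term
    is a unit and the second has value in the maximal ideal; the hypothesis on b makes b / a an
    element of [V]. *)
Lemma fixed_add r g b w v : tw_fixed t r -> @tw_unit t w -> in_frac b ->
  tw_poly t w * g = b *: tw_poly t v -> O (b / r.[x]) ->
  maxO O (b / r.[x] * tw_eval v) -> tw_fixed t (r + g).
Proof.
move=> hr uw fb eg Ob mb; have r0 := fixed_eval_neq0 hr.
case: hr => a [s [u [[fa a0] us uu e]]].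
have := congr1 (horner^~ x) e; rewrite /= hornerM hornerZ -!/(tw_eval _) => ex.
have [s0 Os Osi] := us; have [u0 Ou Oui] := uu.
have ba : b / a = b / r.[x] * (tw_eval u / tw_eval s).
  have -> : a = tw_eval s * r.[x] / tw_eval u by rewrite ex mulfK.
  by field; rewrite s0 r0 u0.
have Oba : O (b / a) by rewrite ba; apply: subringM => //; apply: subringM.
have [d [pd jd]] := frac_V (frac_div fb fa) Oba.
exists a, (s * w), (w * u + tw_const t d * (s * v)); split=> //.
- exact: tw_unitM.
- apply: tw_unitD; first exact: tw_unitM.
  rewrite !tw_evalM tw_evalC // jd ba.
  have -> : b / r.[x] * (tw_eval u / tw_eval s) * (tw_eval s * tw_eval v) =
    b / r.[x] * tw_eval v * tw_eval u by field; rewrite s0 r0.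
  by apply: maxOM => //; apply: tw_O.
- rewrite rmorphD !rmorphM pd.
  transitivity (tw_poly t w * (tw_poly t s * r) + tw_poly t s * (tw_poly t w * g)); first by ring.
  have eb : b%:P = a%:P * (b / a)%:P by rewrite -polyCM mulrCA divff // mulr1.
  by rewrite e eg -!mul_polyC eb; ring.
Qed.

End FixedTame.

(** * Q-adic digits and towers for polynomials of bounded degree *)

(* Dg contains the digits of the Q-adic expansions of the members of T. *)
Definition digits_of (Q : {poly L}) (T Dg : seq {poly L}) : Prop :=
  (forall f, f \in Dg -> [/\ f != 0, poly_over K f & (size f < size Q)%N]) /\
  forall t c, good_tower t -> in_frac c -> c != 0 -> tw_poly t (tw_var t) = c^-1 *: Q ->
    (forall f, f \in Dg -> tw_fixed t f) -> forall f, f \in T -> tw_tame t f.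

(** Repeated division by the monic [Q]: the remainders are the digits, and [tame_digit] reassembles
    f from the last quotient upward. *)
Lemma digits_poly (Q f : {poly L}) : poly_over K Q -> Q \is monic -> (1 < size Q)%N ->
  poly_over K f -> f != 0 -> exists Dg, digits_of Q [:: f] Dg.
Proof.
move=> KQ mQ sQ; have [K_ring _ _] := K_field; have Q0 := monic_neq0 mQ.
have [n] := ubnP (size f); elim: n f => // n IH f sf Kf f0.
have [k0 [q [r [Kq Kr sr]]]] := pseudo_div K_ring Kf KQ Q0.
rewrite (monicP mQ) expr1n mul1r => ef.
have [D1 [hD1 hT1]] : exists D1 : seq {poly L}, (forall g, g \in D1 -> [/\ g != 0, poly_over K g & (size g < size Q)%N]) /\
    forall t c, good_tower t -> in_frac c -> c != 0 -> tw_poly t (tw_var t) = c^-1 *: Q ->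
    (forall g, g \in D1 -> tw_fixed t g) -> q = 0 \/ tw_tame t q.
  case: (eqVneq q 0) => [q0|q0]; first by exists [::]; split=> // *; left.
  have [|D1 [hD1 hT1]] := IH q _ Kq q0.
    have sqQ : size (q * Q) = (size q + (size Q).-1)%N.
      by rewrite size_Mmonic // -!subn1 addnBA // (ltnW sQ).
    have sq : (0 < size q)%N by rewrite lt0n size_poly_eq0.
    have lt : (size q < size f)%N.
      have sQ1 : (0 < (size Q).-1)%N by rewrite -subn1 subn_gt0.
      rewrite ef size_polyDl sqQ; first by rewrite -{1}[size q]addn0 ltn_add2l.
      apply: leq_trans sr _; rewrite -{1}(prednK (ltnW sQ)) -add1n leq_add2r //.
    by apply: leq_trans lt _; rewrite -ltnS.
  by exists D1; split=> // t c gt fc c0 eQ hf; right; apply: (hT1 t c) => //; rewrite inE.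
case: (eqVneq r 0) => [r0|r0].
  exists D1; split=> // t c gt fc c0 eQ hf g; rewrite inE => /eqP->.
  have e : f = 0 + Q * q by rewrite ef r0 addr0 add0r mulrC.
  by rewrite e; apply: (tame_digit gt fc c0 eQ); [left | apply: (hT1 t c) | rewrite -e].
exists (r :: D1); split=> [g|t c gt fc c0 eQ hf g].
  by rewrite inE => /orP[/eqP->|/hD1].
rewrite inE => /eqP->.
have e : f = r + Q * q by rewrite ef addrC mulrC.
rewrite e; apply: (tame_digit gt fc c0 eQ); last by rewrite -e.
  by right; apply: hf; rewrite inE eqxx.
by apply: (hT1 t c) => // h hh; apply: hf; rewrite inE hh orbT.
Qed.

Lemma digits_seq (Q : {poly L}) T : poly_over K Q -> Q \is monic -> (1 < size Q)%N ->
  (forall f, f \in T -> f != 0 /\ poly_over K f) -> exists Dg, digits_of Q T Dg.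
Proof.
move=> KQ mQ sQ; elim: T => [|f T IH] hT; first by exists [::].
have [|D1 [h1 t1]] := IH; first by move=> g gT; apply: hT; rewrite inE gT orbT.
have [f0 Kf] := hT f (mem_head _ _).
have [D2 [h2 t2]] := digits_poly KQ mQ sQ Kf f0.
exists (D2 ++ D1); split=> [g|t c gt fc c0 eQ hf g].
  by rewrite mem_cat => /orP[/h2|/h1].
rewrite inE => /orP[/eqP->|gT].
  by apply: (t2 t c) => //; [move=> h hh; apply: hf; rewrite mem_cat hh | rewrite inE].
by apply: (t1 t c) => // h hh; apply: hf; rewrite mem_cat hh orbT.
Qed.

(** [E] holds the polynomials to be fixed. [T] holds polynomials of any degree that may later give a
    relation: the next [Q], or the minimal polynomial of x. [H] holds elements of K that the base
    must fix, such as the coefficients of that minimal polynomial. *)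
Definition towers_upto (e : nat) : Prop := forall (E T : seq {poly L}) (H : seq L),
  (forall f, f \in E -> [/\ f != 0, poly_over K f & (size f <= e)%N]) ->
  (forall f, f \in T -> f != 0 /\ poly_over K f) ->
  (forall y, y \in H -> K y /\ y != 0) ->
  exists t, [/\ good_tower t, forall f, f \in E -> tw_fixed t f,
    forall f, f \in T -> tw_tame t f & forall y, y \in H -> prs_fixed (tw_base t) y].

(** Constants are handled by the base alone. For [T] the expansion is the ordinary one, with Q = X
    and c = 1, so its digits are constants too. *)
Lemma towers_upto1 : fixable K -> towers_upto 1.
Proof.
move=> fixK E T H hE hT hH; have [K_ring KV Kfrac] := K_field.
have [|||Dg [hD tD]] := @digits_seq 'X T _ _ _ hT.
- exact: poly_overX.
- exact: monicX.
- by rewrite size_polyX.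
have [y|p [gp fp]] := fixK (map (fun f : {poly L} => f`_0) (E ++ Dg) ++ H).
  rewrite mem_cat => /orP[/mapP[f]|/hH//].
  have h0 : f != 0 -> poly_over K f -> (size f <= 1)%N -> K f`_0 /\ f`_0 != 0.
    move=> f0 Kf /size1_polyC e; split; first exact: Kf.
    by apply: contraNneq f0 => e0; rewrite e e0 polyC0.
  rewrite mem_cat => /orP[/hE[f0 Kf sf] ->|/hD[f0 Kf sf] ->]; first exact: h0.
  by apply: h0 => //; rewrite size_polyX ltnS in sf.
have fixC f : f \in E ++ Dg -> tw_fixed (base_tower p) f.
  move=> fE; have /size1_polyC e : (size f <= 1)%N.
    move: fE; rewrite mem_cat => /orP[/hE[_ _ //]|/hD[_ _]].
    by rewrite size_polyX ltnS.
  have [|a [s [u [fa us uu es]]]] := fp f`_0.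
    by rewrite mem_cat; apply/orP; left; apply: (map_f (fun f : {poly L} => f`_0)).
  exists a, s%:P, u%:P; split=> //.
  - by rewrite /tw_unit /tw_eval /= map_polyC hornerC.
  - by rewrite /tw_unit /tw_eval /= map_polyC hornerC.
  - by rewrite e /= !map_polyC /= -polyCM es -mul_polyC polyCM.
have gt := good_base_tower gp.
exists (base_tower p); split=> //.
- by move=> f fE; apply: fixC; rewrite mem_cat fE.
- apply: (tD _ 1) => //.
  + by case: K_field => _ _ _; rewrite -(rmorph1 j); apply: frac_j.
  + by rewrite oner_eq0.
  + by rewrite /= map_polyX invr1 scale1r.
  + by move=> f fD; apply: fixC; rewrite mem_cat fD orbT.
- by move=> y yH; apply: fp; rewrite mem_cat yH orbT.
Qed.

(** Picks f / lc(f) of largest value at x among the members of [E], with X^e as initial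
    candidate. *)
Lemma best_monic e (E : seq {poly L}) :
  (forall f, f != 0 -> poly_over K f -> (size f <= e.+1)%N -> f.[x] != 0) ->
  (forall f, f \in E -> [/\ f != 0, poly_over K f & size f = e.+1]) ->
  exists M, [/\ M \is monic, poly_over K M, size M = e.+1 &
    forall f, f \in E -> O (M.[x] * lead_coef f / f.[x])].
Proof.
move=> hx; have [K_ring KV Kfrac] := K_field; have rK := poly_over_subring K_ring.
elim: E => [|f E IH] hE.
  exists 'X^e; split=> //; [exact: monicXn | | by rewrite size_polyXn].
  by apply: (subringX rK); apply: poly_overX.
have [|M [mM KM sM hM]] := IH; first by move=> g gE; apply: hE; rewrite inE gE orbT.
have [f0 Kf sf] := hE f (mem_head _ _).
have fx : f.[x] != 0 by apply: hx => //; rewrite sf.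
have Mx : M.[x] != 0 by apply: hx => //; [apply: monic_neq0 | rewrite sM].
have lf : lead_coef f != 0 by rewrite lead_coef_eq0.
case: (O_total (M.[x] * lead_coef f / f.[x])) => hO.
  by exists M; split=> // g; rewrite inE => /orP[/eqP->|/hM].
exists ((lead_coef f)^-1 *: f); split.
- by rewrite monicE lead_coefZ mulVf.
- by rewrite -mul_polyC; apply: (subringM rK) => //; apply: poly_overC => //; apply: KV; apply: Kf.
- by rewrite size_scale ?invr_eq0.
- move=> g; rewrite inE hornerZ => /orP[/eqP->|gE].
    have -> : (lead_coef f)^-1 * f.[x] * lead_coef f / f.[x] = 1 by field; apply/andP.
    exact: subring1.
  have [g0 Kg sg] := hE g ltac:(by rewrite inE gE orbT).
  have gx : g.[x] != 0 by apply: hx => //; rewrite sg.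
  have -> : (lead_coef f)^-1 * f.[x] * lead_coef g / g.[x] =
      (M.[x] * lead_coef f / f.[x])^-1 * (M.[x] * lead_coef g / g.[x]).
    by field; rewrite lf Mx gx fx.
  by apply: subringM => //; apply: hM.
Qed.

(** Immediacy improves the best monic polynomial to a [Q] of strictly larger value. Every f of
    degree e is then lc(f) Q plus a remainder of lower degree that dominates at x, so fixing the
    remainder leads to fixing f. *)
Lemma towers_uptoS e : (0 < e)%N ->
  (forall f, f != 0 -> poly_over K f -> (size f <= e.+1)%N -> f.[x] != 0) ->
  towers_upto e -> towers_upto e.+1.
Proof.
move=> e0 hx IH E T H hE hT hH.
have [K_ring KV Kfrac] := K_field; have rK := poly_over_subring K_ring.
have [|M [mM KM sM hM]] := @best_monic e [seq f : {poly L} <- E | size f == e.+1] hx.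
  by move=> f; rewrite mem_filter => /andP[/eqP sf /hE[f0 Kf _]].
have Mx : M.[x] != 0 by apply: hx => //; [apply: monic_neq0 | rewrite sM].
(* [a] has the same leading behaviour as M(x); hence Q = M - a has larger value at x than a, and so
   than each f / lc(f). *)
have [a [fa ma]] := immediate Mx.
have uaM : unitO O (a / M.[x]).
  have -> : a / M.[x] = 1 + (-1) * ((M.[x] - a) / M.[x]) by field.
  apply: unitO_addM => //; first exact: unitO1.
  by apply: maxOMl => //; apply: subringN => //; apply: subring1.
have a0 : a != 0 by case: uaM => h _ _; apply: contraNneq h => ->; rewrite mul0r.
pose Q := M - a%:P.
have sQ : size Q = e.+1.
  by rewrite /Q size_polyDl sM // size_polyN size_polyC a0.
have mQ : Q \is monic.
  rewrite monicE /lead_coef sQ coefB coefC; case: e e0 sM {hx hM IH hE sQ} => // e _ sM.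
  by rewrite subr0 -(monicP mM) /lead_coef sM.
have KQ : poly_over K Q by apply: (subringB rK) => //; apply: poly_overC => //; apply: Kfrac.
have Q0 := monic_neq0 mQ.
have Qa : maxO O (Q.[x] / a).
  have -> : Q.[x] / a = (M.[x] - a) / M.[x] * (a / M.[x])^-1.
    by rewrite hornerD hornerN hornerC; field; apply/andP.
  by apply: maxOM => //; case: uaM.
pose rest (f : {poly L}) : {poly L} := if size f == e.+1 then f - lead_coef f *: Q else f.
have restP f : f \in E -> size f = e.+1 ->
    [/\ rest f != 0, (size (rest f) <= e)%N & O (a * lead_coef f / (rest f).[x])].
  move=> fE sf; have [f0 Kf _] := hE f fE.
  have fx : f.[x] != 0 by apply: hx => //; rewrite sf.
  have Of : O (a * lead_coef f / f.[x]).
    have -> : a * lead_coef f / f.[x] = a / M.[x] * (M.[x] * lead_coef f / f.[x]).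
      by field; rewrite fx Mx.
    by apply: subringM; [| case: uaM | apply: hM; rewrite mem_filter sf eqxx].
  have er : rest f = f - lead_coef f *: Q by rewrite /rest sf eqxx.
  have ur : unitO O ((rest f).[x] / f.[x]).
    have -> : (rest f).[x] / f.[x] = 1 + (- 1 * (a * lead_coef f / f.[x])) * (Q.[x] / a).
      by rewrite er hornerD hornerN hornerZ; field; apply/andP.
    apply: unitO_addM => //; first exact: unitO1.
    by apply: maxOMl => //; apply: subringM => //; apply: subringN => //; apply: subring1.
  have rx : (rest f).[x] != 0 by case: ur => h _ _; apply: contraNneq h => ->; rewrite mul0r.
  split.
  - by apply: contraNneq rx => ->; rewrite horner0.
  - rewrite er; apply/leq_sizeP => i; rewrite leq_eqVlt coefB coefZ => /orP[/eqP<-|ei].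
      have -> : Q`_e = 1 by move/monicP: mQ; rewrite /lead_coef sQ.
      by rewrite mulr1 /lead_coef sf subrr.
    by rewrite !nth_default ?mulr0 ?subrr ?sf ?sQ.
  - have -> : a * lead_coef f / (rest f).[x] =
        a * lead_coef f / f.[x] * ((rest f).[x] / f.[x])^-1.
      by field; apply/andP.
    by apply: subringM => //; case: ur.
have [|Dg [hD tD]] := @digits_seq Q T KQ mQ _ hT; first by rewrite sQ.
(* The remainders, the leading coefficients and the digits of [T] all have degree below e. [Q] is
   requested tame so that it can define the next variable. *)
have [|||t [gt fE tT pH]] :=
  IH (map rest E ++ [seq (lead_coef f)%:P | f : {poly L} <- E] ++ Dg) (Q :: T) H.
- move=> g; rewrite !mem_cat => /or3P[/mapP[f fE ->]|/mapP[f /hE[f0 Kf _] ->]|/hD[g0 Kg]].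
  + have [f0 Kf sf] := hE f fE; case: (eqVneq (size f) e.+1) => sfe.
      have [r0 sr _] := restP f fE sfe; split=> //.
      rewrite /rest sfe eqxx -mul_polyC; apply: (subringB rK) => //; apply: (subringM rK) => //.
      by apply: poly_overC => //; apply: Kf.
    by rewrite /rest (negPf sfe); split=> //; rewrite -ltnS ltn_neqAle sfe.
  + split; rewrite ?polyC_eq0 ?lead_coef_eq0 //; first by apply: poly_overC => //; apply: Kf.
    by rewrite (leq_trans (size_polyC_leq1 _)).
  + by rewrite sQ ltnS.
- by move=> g; rewrite inE => /orP[/eqP->|/hT].
- exact: hH.
have frest f : f \in E -> tw_fixed t (rest f) by move=> fE'; apply: fE; rewrite mem_cat (map_f rest).
have flead f : f \in E -> tw_fixed t (lead_coef f)%:P.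
  by move=> fE'; apply: fE; rewrite !mem_cat (map_f (fun f : {poly L} => (lead_coef f)%:P) fE') orbT.
have [aQ [s [G [[faQ aQ0] us rG eQ]]]] := tT Q (mem_head _ _).
have leadO (t1 : tower) (gt1 : good_tower t1) (f : {poly L}) : f \in E -> size f = e.+1 ->
  tw_fixed t1 (lead_coef f)%:P -> exists al sl ul, [/\ in_frac al /\ al != 0, tw_unit sl,
    @tw_unit t1 ul, tw_poly t1 sl * (lead_coef f)%:P = al *: tw_poly t1 ul &
    O (al * a / (rest f).[x])].
  move=> fE' sf [al [sl [ul [[fal al0] usl uul el]]]]; exists al, sl, ul; split=> //.
  have [r0 sr Or] := restP f fE' sf.
  have := congr1 (horner^~ x) el; rewrite /= hornerM hornerC hornerZ -!/(tw_eval _) => ex.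
  have [u0 Ou Oui] := uul; have [s0 Os Osi] := usl.
  have -> : al * a / (rest f).[x] = a * lead_coef f / (rest f).[x] * (tw_eval sl / tw_eval ul).
    have -> : al = tw_eval sl * lead_coef f / tw_eval ul by rewrite ex mulfK.
    by ring.
  by apply: subringM => //; apply: subringM.
(* Q = aQ G / s in t: link if the value of a is at least that of aQ, and
   otherwise Q is too small to be seen by t and t already works *)
case: (classic (O (a / aQ))) => hO.
  have [d jd] := O_frac (frac_div fa faQ) hO.
  pose t' := link_tower Q a s G d.
  have gt' : good_tower t' by apply: (good_link_tower gt KQ fa a0 aQ0 Qa us rG eQ jd).
  have fix' f : tw_fixed t f -> tw_fixed t' f by apply: link_fixed.
  exists t'; split=> //.
  - move=> f fE'; case: (eqVneq (size f) e.+1) => sf; last first.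
      by apply: fix'; have := frest f fE'; rewrite /rest (negPf sf).
    have [al [sl [ul [[fal al0] usl uul el Oal]]]] := leadO t' gt' f fE' sf (fix' _ (flead f fE')).
    have -> : f = rest f + (lead_coef f)%:P * Q by rewrite /rest sf eqxx mul_polyC subrK.
    (* Here lc(f) = al ul / sl and Q = a Z, so the added term is al a times (ul / sl) Z, and Z has
       value in the maximal ideal. *)
    apply: (fixed_add gt' (b := al * a) (w := sl) (v := ul * tw_var t')) => //.
    + exact: (fix' _ (frest f fE')).
    + exact: fracM.
    + by rewrite mulrA el rmorphM [tw_poly t' (tw_var t')]link_polyX -scalerAl -scalerAr scalerA mulfK.
    + rewrite tw_evalM; apply: maxOMl => //; apply: maxOMl => //; first exact: tw_O.
      exact: tw_var_max.
  - apply: (tD t' a gt' fa a0).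
      exact: link_polyX.
    by move=> f fD; apply: fix'; apply: fE; rewrite !mem_cat fD !orbT.
have := not_O_maxOV O_total hO; rewrite invf_div => maQ.
exists t; split=> //; last by move=> f fT; apply: tT; rewrite inE fT orbT.
move=> f fE'; case: (eqVneq (size f) e.+1) => sf; last first.
  by have := frest f fE'; rewrite /rest (negPf sf).
have [al [sl [ul [[fal al0] usl uul el Oal]]]] := leadO t gt f fE' sf (flead f fE').
have -> : f = rest f + (lead_coef f)%:P * Q by rewrite /rest sf eqxx mul_polyC subrK.
(* The factor aQ / a already lies in the maximal ideal, so for the value of G it is enough to be in
   O. *)
have mal : maxO O (al * aQ / (rest f).[x]).
  have -> : al * aQ / (rest f).[x] = al * a / (rest f).[x] * (aQ / a).
    by have rx := fixed_eval_neq0 (frest f fE'); field; rewrite rx a0.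
  exact: maxOMl.
apply: (fixed_add gt (b := al * aQ) (w := sl * s) (v := ul * G)) => //.
- exact: frest.
- exact: tw_unitM.
- exact: fracM.
- rewrite !rmorphM.
  transitivity (tw_poly t sl * (lead_coef f)%:P * (tw_poly t s * Q)); first by ring.
  by rewrite el eQ -!mul_polyC polyCM; ring.
- by case: mal.
- by apply: maxOM => //; apply: tw_O.
Qed.

(** * Passing from K to K(x) *)

Definition adjoin_field (y : L) : Prop :=
  exists f g, [/\ poly_over K f, poly_over K g, g.[x] != 0 & y = f.[x] / g.[x]].

Lemma adjoin_fieldK y : K y -> adjoin_field y.
Proof.
case: K_field => K_ring _ _ Ky; exists y%:P, 1; rewrite !hornerC oner_eq0 divr1.
by split=> //; [apply: poly_overC | apply: (subring1 (poly_over_subring K_ring))].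
Qed.

Lemma adjoin_field_horner f : poly_over K f -> adjoin_field f.[x].
Proof.
case: K_field => K_ring _ _ Kf; exists f, 1; rewrite hornerC oner_eq0 divr1.
by split=> //; apply: (subring1 (poly_over_subring K_ring)).
Qed.

Lemma adjoin_subfield : subfield adjoin_field.
Proof.
case: (K_field) => K_ring _ Kfrac; have rK := poly_over_subring K_ring.
split=> [|_ [f [g [Kf Kg gx ->]]]|y /Kfrac]; last exact: adjoin_fieldK; last first.
  case: (eqVneq f.[x] 0) => fx.
    by rewrite fx mul0r invr0; apply: adjoin_fieldK; apply: (subring0 K_ring).
  by exists g, f; rewrite invf_div.
split=> [|_ _ [f [g [Kf Kg gx ->]]] [f' [g' [Kf' Kg' gx' ->]]]
  |_ _ [f [g [Kf Kg gx ->]]] [f' [g' [Kf' Kg' gx' ->]]]].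
- by apply: adjoin_fieldK; apply: (subring1 K_ring).
- exists (f * g' - f' * g), (g * g'); split.
  + by apply: (subringB rK); apply: (subringM rK).
  + exact: (subringM rK).
  + by rewrite hornerM mulf_neq0.
  + by rewrite hornerD hornerN !hornerM; field; apply/andP.
- exists (f * f'), (g * g'); split; try exact: (subringM rK).
  + by rewrite hornerM mulf_neq0.
  + by rewrite !hornerM; field; apply/andP.
Qed.

Definition tw_prs t (P : seq (tw_ring t)) : presentation :=
  @Presentation (tw_ring t) (tw_const t) (horner_eval x \o tw_poly t) P.

Lemma presents_tw_prs t P : good_tower t -> reg_seq (@tw_unit t) P ->
  (forall f : tw_ring t, tw_eval f = 0 -> sat (@tw_unit t) (gen P) f) ->
  (forall f, f \in P -> tw_eval f = 0) -> presents adjoin_field (tw_prs P).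
Proof.
move=> gt rP kP P0; split=> //; first exact: tw_alg.
- exact: (tw_evalC gt).
- exact: (tw_O gt).
- by move=> f; apply: adjoin_field_horner; apply: tw_K.
Qed.

Lemma prs_fixed_div t P f g : tw_fixed t f -> tw_fixed t g ->
  @prs_fixed (@tw_prs t P) (f.[x] / g.[x]).
Proof.
move=> hf hg; have gx := fixed_eval_neq0 hg.
case: hf => a [s [u [[fa a0] us uu e]]]; case: hg => b [w [v [[fb b0] uw uv e']]].
have := congr1 (horner^~ x) e; rewrite /= hornerM hornerZ -!/(tw_eval _) => ex.
have := congr1 (horner^~ x) e'; rewrite /= hornerM hornerZ -!/(tw_eval _) => ex'.
exists (a / b), (s * v), (u * w); split.
- by rewrite mulf_neq0 ?invr_eq0 //; split=> //; apply: frac_div.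
- exact: (tw_unitM us uv).
- exact: (tw_unitM uu uw).
- rewrite -[LHS]/(tw_eval (s * v) * _) -[RHS]/(_ * tw_eval (u * w)) !tw_evalM.
  have [v0 _ _] := uv; have [w0 _ _] := uw; have [s0 _ _] := us.
  have -> : g.[x] = b * tw_eval v / tw_eval w by rewrite -ex' mulrC mulKf.
  have -> : f.[x] = a * tw_eval u / tw_eval s by rewrite -ex mulrC mulKf.
  by field; rewrite v0 w0 s0 b0.
Qed.

(** A fixed coefficient is (a / b) (u / s), so b s clears its denominator; the product over all
    coefficients clears them together. *)
Lemma clear_denominators p (h : {poly L}) : presents K p ->
  (forall i, h`_i != 0 -> prs_fixed p h`_i) ->
  exists d h1, [/\ prs_eval p d != 0, map_poly (prs_eval p) h1 = prs_eval p d *: h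
    & size h1 = size h].
Proof.
move=> gp hh.
have coef i : exists d m, prs_eval p d != 0 /\ prs_eval p d * h`_i = prs_eval p m.
  case: (eqVneq h`_i 0) => [->|hi].
    by exists 1, 0; rewrite rmorph1 oner_eq0 mulr0 rmorph0.
  have [_ [s [u [[[a [b [b0 ->]]] _] [s0 _ _] _ e]]]] := hh i hi.
  exists (prs_const p b * s), (prs_const p a * u).
  by rewrite !rmorphM !(prs_evalC gp) mulf_neq0 // -mulrA e; split=> //; field.
have [d [d0 hd]] : exists d, prs_eval p d != 0 /\
    forall i, (i < size h)%N -> exists m, prs_eval p d * h`_i = prs_eval p m.
  elim: (size h) => [|n [d [d0 hd]]]; first by exists 1; rewrite rmorph1 oner_eq0.
  have [d' [m [d'0 e]]] := coef n; exists (d * d').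
  rewrite rmorphM mulf_neq0 //; split=> // i; rewrite ltnS leq_eqVlt => /orP[/eqP->|/hd[m' e']].
    by exists (d * m); rewrite rmorphM -mulrA e.
  by exists (d' * m'); rewrite rmorphM mulrAC e' mulrC.
have hm i : exists m, (i < size h)%N -> prs_eval p d * h`_i = prs_eval p m.
  case: (ltnP i (size h)) => [/hd[m e]|_]; [by exists m | by exists 0].
pose m i := proj1_sig (constructive_indefinite_description _ (hm i)).
have mP i : (i < size h)%N -> prs_eval p d * h`_i = prs_eval p (m i).
  by rewrite /m; case: constructive_indefinite_description.
exists d, (\poly_(i < size h) m i); split=> //.
  apply/polyP => i; rewrite coef_map coef_poly coefZ; case: ltnP => ih; first by rewrite mP.
  by rewrite /= ?rmorph0 nth_default // mulr0.
case: (eqVneq h 0) => [->|h0]; first by rewrite size_poly0 poly_def big_ord0 size_poly0.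
apply: size_poly_eq; apply: contraNneq d0 => m0.
have := mP (size h).-1; rewrite m0 rmorph0 prednK ?leqnn ?lt0n ?size_poly_eq0 //.
by move/(_ isT)/eqP; rewrite mulf_eq0 -[h`_ _]/(lead_coef h) lead_coef_eq0 (negPf h0) orbF.
Qed.

(** Here h is a minimal polynomial of x and s h = a G; adding G as the last relation turns the
    kernel of the map to L[X] into the kernel of evaluation at x. *)
Lemma presents_closed_tower t h : good_tower t -> tw_tame t h -> poly_over K h -> h != 0 ->
  h.[x] = 0 ->
  (forall f, f != 0 -> poly_over K f -> (size f < size h)%N -> f.[x] != 0) ->
  (forall i, h`_i != 0 -> prs_fixed (tw_base t) h`_i) ->
  exists P, presents adjoin_field (@tw_prs t P).
Proof.
move=> gt [a [s [G [[fa a0] us rG eG]]]] Kh h0 hx hmin hfix.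
have gp := tw_base_good gt.
have s0 := tw_unit_neq0 us.
have G0 : tw_poly t G != 0.
  by apply: contraNneq h0 => G0; move/eqP: eG; rewrite G0 scaler0 mulf_eq0 (negPf s0).
have idP := gen_ideal (tw_rels t).
have ker0 y : gen (tw_rels t) y -> tw_poly t y = 0 by apply: gen_rmorph0; apply: tw_rels0.
pose P := rcons (tw_rels t) G.
(* As for a link: [G] cancels modulo the relations and b, so its cofactor is a multiple of b up to
   the relations and a unit, and b is then cancelled in L[X]. *)
have torsion b (y : tw_ring t) : prs_eval (tw_base t) b != 0 ->
    gen P (tw_in t b * y) -> sat (@tw_unit t) (gen P) y.
  move=> b0 /gen_rcons[p1 [q [hp1 ey]]].
  have [|u [uu /gen_cons[p2 [c [hp2 eq]]]]] := @nzd_G t G gt rG b q.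
    have -> : G * q = tw_in t b * y - p1 by rewrite ey addrAC subrr add0r mulrC.
    have idP' := gen_ideal (tw_in t b :: tw_rels t).
    apply: (is_idealB idP').
      by apply: (is_idealMr _ idP'); apply: gen_mem; rewrite inE eqxx.
    by apply: gen_subset hp1 => z zP; rewrite inE zP orbT.
  have [|v [uv hv]] := @tw_ker t gt (u * y - c * G).
    have : tw_poly t (tw_in t b * (u * y - c * G)) = 0.
      apply: ker0; have -> : tw_in t b * (u * y - c * G) = u * p1 + p2 * G.
        rewrite mulrBr mulrCA ey mulrDr [u * (q * G)]mulrA eq; ring.
      by apply: (is_idealD idP); [apply: (is_idealMl _ idP) | apply: (is_idealMr _ idP)].
    by rewrite rmorphM (tw_polyC gt) => /eqP; rewrite mulf_eq0 polyC_eq0 (negPf b0) => /eqP.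
  exists (v * u); split; first exact: tw_unitM.
  apply/gen_rcons; exists (v * (u * y - c * G)), (v * c); split=> //; ring.
have KP y : gen (tw_rels t) y -> gen P y.
  by apply: gen_subset => z zP; rewrite mem_rcons inE zP orbT.
exists P; apply: presents_tw_prs => //.
- apply: reg_seq_rcons; first exact: tw_reg.
  move=> y [u [uu hu]]; have [|v [uv hv]] := @tw_ker t gt (u * y).
    have := ker0 _ hu; rewrite mulrA rmorphM => /eqP; rewrite mulf_eq0 (negPf G0) orbF.
    by move/eqP.
  by exists (v * u); rewrite -mulrA; split=> //; apply: tw_unitM.
- move=> f fx.
  have [d0 [h1 [d00 eh1 sh1]]] := clear_denominators gp hfix.
  have h10 : h1 != 0 by rewrite -size_poly_eq0 sh1 size_poly_eq0.
  (* Elimination makes s1 c f a polynomial f1 over the base, which is divided by the multiple h1 of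
     h. The remainder vanishes at x in degree below that of h, so it is zero. *)
  have [s1 [c [f1 [f2 [us1 jc _ ef1]]]]] := tw_elim gt f.
  have ring_True : subring (fun _ : prs_ring (tw_base t) => True) by [].
  have polyT (g : {poly prs_ring (tw_base t)}) : poly_over (fun _ => True) g by [].
  have [n [q [r [_ _ sr eq]]]] := pseudo_div ring_True (polyT f1) (polyT h1) h10.
  pose ev := prs_eval (tw_base t).
  have {}eq : (ev (lead_coef h1) ^+ n)%:P * map_poly ev f1 =
      map_poly ev q * (ev d0 *: h) + map_poly ev r.
    by rewrite -eh1 -rmorphM -rmorphD -eq rmorphM /= map_polyC /= rmorphXn.
  have r0 : map_poly ev r = 0.
    case: (eqVneq (map_poly ev r) 0) => // rn0.
    have [||] := negP (hmin _ rn0 _ _); first by move=> i; rewrite coef_map; apply: (prs_K gp).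
      by apply: leq_ltn_trans (size_poly _ _) _; rewrite -sh1.
    have := congr1 (horner^~ x) eq; rewrite /= hornerD !hornerM hornerZ hx !mulr0 add0r => <-.
    by rewrite -ef1 -/(tw_eval _) tw_evalM fx !mulr0.
  have [z ez] := tw_gen gt.
  have [w ew] : exists w, tw_poly t w = map_poly ev q.
    elim/poly_ind: q {eq} => [|g b [w ew]]; first by exists 0; rewrite !rmorph0.
    exists (w * z + tw_in t b); rewrite !rmorphD !rmorphM ew ez (tw_polyC gt) /=.
    by rewrite map_polyX map_polyC.
  have [a1 [b1 [b10 ea]]] := fa.
  pose cn := prs_const (tw_base t).
  (* [D1] absorbs the leading coefficients from the division, the constant c and the denominator of
     a, so that D1 s s1 f = w' G holds in L[X]. *)
  pose D1 := lead_coef h1 ^+ n * cn c * cn b1.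
  pose w' := w * tw_in t (d0 * cn a1).
  have D10 : ev D1 != 0.
    rewrite /ev !rmorphM rmorphXn !(prs_evalC gp) !mulf_neq0 // expf_neq0 //.
    have <- : lead_coef (map_poly ev h1) = ev (lead_coef h1).
      rewrite /lead_coef coef_map size_poly_eq //; apply: contraNneq h0 => e0.
      have := congr1 lead_coef eh1; rewrite lead_coefZ => /eqP.
      have sz : (size (map_poly ev h1) = size h1)%N by rewrite eh1 size_scale ?sh1.
      rewrite {1}/lead_coef sz coef_map => /eqP e1.
      have : prs_eval (tw_base t) d0 * lead_coef h = 0 by rewrite -e1; exact: e0.
      move/eqP; rewrite mulf_eq0 (negPf d00).
      by rewrite lead_coef_eq0.
    by rewrite eh1 lead_coefZ mulf_neq0 // lead_coef_eq0.
  have [|u [uu hu]] := @tw_ker t gt (tw_in t D1 * (s * s1 * f) - w' * G).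
    rewrite rmorphB; apply/eqP; rewrite subr_eq0; apply/eqP.
    have -> : tw_in t D1 * (s * s1 * f) =
      tw_in t (lead_coef h1 ^+ n) * tw_const t b1 * s * (s1 * tw_const t c * f).
      by rewrite !rmorphM /tw_const /= /cn; ring.
    rewrite [LHS]rmorphM ef1 !rmorphM !(tw_polyC gt) /cn !(prs_evalC gp) ew rmorphXn.
    transitivity ((j b1)%:P * tw_poly t s * ((ev (lead_coef h1) ^+ n)%:P * map_poly ev f1)).
      by rewrite -/ev; ring.
    rewrite eq r0 addr0 -!mul_polyC.
    transitivity ((j b1)%:P * map_poly ev q * (ev d0)%:P * (tw_poly t s * h)); first by ring.
    have eja : (j a1)%:P = a%:P * (j b1)%:P by rewrite -polyCM ea divfK.
    by rewrite eG -mul_polyC eja /ev; ring.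
  have [|v [uv hv]] := torsion D1 (u * (s * s1 * f)) D10.
    have -> : tw_in t D1 * (u * (s * s1 * f)) =
      u * (tw_in t D1 * (s * s1 * f) - w' * G) + (u * w') * G by ring.
    by apply/gen_rcons; exists (u * (tw_in t D1 * (s * s1 * f) - w' * G)), (u * w').
  exists (v * u * (s * s1)); split; first by do !apply: tw_unitM => //.
  by move: hv; rewrite -!mulrA.
- move=> f; rewrite mem_rcons inE => /orP[/eqP->|/(tw_rels0 gt) f0]; last first.
    by rewrite /tw_eval f0 horner0.
  have := congr1 (horner^~ x) eG; rewrite /= hornerM hornerZ hx mulr0 => /esym/eqP.
  by rewrite mulf_eq0 (negPf a0) => /eqP.
Qed.

Lemma towers_all N : fixable K -> (0 < N)%N ->
  (forall f, f != 0 -> poly_over K f -> (size f <= N)%N -> f.[x] != 0) -> towers_upto N.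
Proof.
move=> fixK; case: N => // N _; elim: N => [|N IH] hx; first exact: towers_upto1.
by apply: towers_uptoS => //; apply: IH => f f0 Kf sf; apply: hx => //; apply: leq_trans sf _.
Qed.

Lemma adjoin_repr N (E : seq L) :
  (forall y, y \in E -> y != 0 /\ exists f g, [/\ poly_over K f, poly_over K g,
      (size f <= N)%N /\ (size g <= N)%N, g.[x] != 0 & y = f.[x] / g.[x]]) ->
  exists F : seq {poly L}, (forall f, f \in F -> [/\ f != 0, poly_over K f & (size f <= N)%N]) /\
    forall y, y \in E -> exists f g, [/\ f \in F, g \in F & y = f.[x] / g.[x]].
Proof.
elim: E => [|y E IH] hE; first by exists [::].
have [|F [hF hF']] := IH; first by move=> z zE; apply: hE; rewrite inE zE orbT.
have [y0 [f [g [Kf Kg [sf sg] gx ey]]]] := hE y (mem_head _ _).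
exists [:: f, g & F]; split=> [h|z].
  rewrite !inE => /or3P[/eqP->|/eqP->|/hF//]; split=> //.
    by apply: contraNneq y0 => f0; rewrite ey f0 horner0 mul0r.
  by apply: contraNneq gx => ->; rewrite horner0.
rewrite inE => /orP[/eqP->|/hF'[f' [g' [h1 h2 e]]]].
  by exists f, g; rewrite !inE !eqxx orbT.
by exists f', g'; rewrite !inE h1 h2 !orbT.
Qed.

(** If x is transcendental over K, evaluation at x is injective on the polynomials of a tower, which
    is therefore a presentation already. If x is algebraic, all representatives are taken of degree
    below the minimal polynomial g, and the tower is closed by the relation coming from g. *)
Lemma fixable_adjoin : fixable K -> fixable adjoin_field.
Proof.
move=> fixK E hE; have [K_ring KV Kfrac] := K_field; have rK := poly_over_subring K_ring.
case: (classic (exists h, [/\ h != 0, poly_over K h & h.[x] = 0])) => [[h [h0 Kh hx]]|alg]; last first.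
  have nz f : f != 0 -> poly_over K f -> f.[x] != 0.
    by move=> f0 Kf; apply/negP => /eqP fx; apply: alg; exists f.
  have [N hN] : exists N, forall y, y \in E -> y != 0 /\ exists f g, [/\ poly_over K f,
      poly_over K g, (size f <= N)%N /\ (size g <= N)%N, g.[x] != 0 & y = f.[x] / g.[x]].
    elim: E hE => [|y E IH] hE; first by exists 0%N.
    have [|N hN] := IH; first by move=> z zE; apply: hE; rewrite inE zE orbT.
    have [[f [g [Kf Kg gx ey]]] y0] := hE y (mem_head _ _).
    exists (maxn N (maxn (size f) (size g))) => z; rewrite inE => /orP[/eqP->|zE].
      by split=> //; exists f, g; split=> //; rewrite !leq_max !leqnn ?orbT.
    have [z0 [f' [g' [Kf' Kg' [sf sg] gx' ez]]]] := hN z zE.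
    by split=> //; exists f', g'; split=> //; rewrite !leq_max sf sg.
  have [F [hF hF']] := adjoin_repr hN.
  have TU := @towers_all N.+1 fixK isT (fun f f0 Kf _ => nz f f0 Kf).
  have [||//|t [gt fF _ _]] := TU F [::] [::]; try by [].
  - by move=> f /hF[f0 Kf sf]; split=> //; apply: leqW.
  exists (tw_prs (tw_rels t)); split.
    apply: presents_tw_prs => //; [exact: tw_reg | | by move=> f /(tw_rels0 gt) f0; rewrite /tw_eval f0 horner0].
    move=> f fx; apply: tw_ker => //; case: (eqVneq (tw_poly t f) 0) => // f0.
    by have := nz _ f0 (tw_K gt f); rewrite -/(tw_eval f) fx eqxx.
  by move=> y /hF'[f [g [/fF ff /fF fg ->]]]; apply: prs_fixed_div.
have [N [g [g0 Kg gx sg hmin]]] : exists N g, [/\ g != 0, poly_over K g, g.[x] = 0, size g = N.+1 &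
    forall f, f != 0 -> poly_over K f -> (size f <= N)%N -> f.[x] != 0].
  have [n] := ubnP (size h); elim: n h h0 Kh hx => // n IH h h0 Kh hx sh.
  case: (classic (exists f, [/\ f != 0, poly_over K f, (size f < size h)%N & f.[x] = 0])).
    by move=> [f [f0 Kf sf fx]]; apply: (IH f) => //; apply: leq_trans sf _.
  move=> hn; exists (size h).-1, h; have sh0 : (0 < size h)%N by rewrite lt0n size_poly_eq0.
  split=> //; first by rewrite prednK.
  move=> f f0 Kf sf; apply/negP => /eqP fx; apply: hn; exists f; split=> //.
  by rewrite -(prednK sh0) ltnS.
have N0 : (0 < N)%N.
  rewrite lt0n; apply/negP => /eqP N0; move: sg; rewrite N0 => /eqP/size_poly1P[c c0 eg].
  by move: gx; rewrite eg hornerC => /eqP; rewrite (negPf c0).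
(* Division by g keeps numerators and denominators in the degrees where no nonzero polynomial over K
   vanishes at x. *)
have reduce f : poly_over K f -> exists f', [/\ poly_over K f', (size f' <= N)%N & f'.[x] = f.[x]].
  move=> Kf; have [n [q [r [Kq Kr sr e]]]] := pseudo_div K_ring Kf Kg g0.
  have lg : lead_coef g != 0 by rewrite lead_coef_eq0.
  exists (((lead_coef g) ^+ n)^-1 *: r); split.
  - rewrite -mul_polyC; apply: (subringM rK) => //; apply: poly_overC => //; apply: KV.
    by apply: subringX => //; apply: Kg.
  - by rewrite (leq_trans (size_scale_leq _ _)) // -ltnS -sg.
  - have := congr1 (horner^~ x) e; rewrite /= hornerM hornerC hornerD hornerM gx mulr0 add0r hornerZ => <-.
    by rewrite mulKf // expf_neq0.
have hE' y : y \in E -> y != 0 /\ exists f g, [/\ poly_over K f,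
      poly_over K g, (size f <= N)%N /\ (size g <= N)%N, g.[x] != 0 & y = f.[x] / g.[x]].
  move=> /hE[[f1 [f2 [K1 K2 fx ->]]] y0]; split=> //.
  have [g1 [Kg1 sg1 e1]] := reduce f1 K1; have [g2 [Kg2 sg2 e2]] := reduce f2 K2.
  by exists g1, g2; rewrite e1 e2.
have [F [hF hF']] := adjoin_repr hE'.
have [||t [gt fF tT pH]] := towers_all fixK N0 hmin (T := [:: g]) (H := [seq c <- polyseq g | c != 0]) hF.
- by move=> f; rewrite inE => /eqP->.
- by move=> y; rewrite mem_filter => /andP[y0 /(nthP 0)[i _ e]]; split=> //; rewrite -e; apply: Kg.
have [|i gi|P hP] := presents_closed_tower gt (tT g (mem_head _ _)) Kg g0 gx.
- by move=> f f0 Kf; rewrite sg ltnS; apply: hmin.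
- apply: pH; rewrite mem_filter gi mem_nth //.
  by rewrite ltnNge; apply: contra gi => /(nth_default 0)->.
exists (tw_prs P); split=> // y /hF'[f1 [f2 [/fF h1 /fF h2 ->]]]; exact: prs_fixed_div.
Qed.

End Tower.

(** * Adjoining generators one at a time *)

Lemma fixable_all (E : seq L) : (forall y, y \in E -> O y) ->
  exists K, [/\ subfield K, fixable K & forall y, y \in E -> K y].
Proof.
elim: E => [|y E IH] hE; first by exists in_frac; split=> //; [apply: frac_subfield | apply: fixable_frac].
have [|K [sK fK hK]] := IH; first by move=> z zE; apply: hE; rewrite inE zE orbT.
(* Towers require a generator in the maximal ideal, so [y] is translated by an element of Frac V. *)
have [a [fa ma]] : exists a, in_frac a /\ maxO O (y - a).
  have Oy := hE y (mem_head _ _).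
  case: (eqVneq y 0) => [->|y0].
    by exists 0; rewrite subr0; split; [rewrite -(rmorph0 j); apply: frac_j | apply: maxO0].
  have [a [fa ma]] := immediate y0; exists a; split=> //.
  by rewrite -[y - a](divfK y0); apply: maxOM.
exists (adjoin_field K (y - a)); split; first exact: adjoin_subfield.
  exact: fixable_adjoin.
have [K_ring _ Kfrac] := sK.
move=> z; rewrite inE => /orP[/eqP->|/hK Kz]; last exact: adjoin_fieldK.
suff : adjoin_field K (y - a) ('X + a%:P).[y - a] by rewrite hornerD hornerX hornerC subrK.
apply: adjoin_field_horner => //; apply: (subringD (poly_over_subring K_ring)).
  exact: poly_overX.
by apply: poly_overC => //; apply: Kfrac.
Qed.

(** If y = a u / s lies in O, then so does a, which thus comes from [V]; hence y lies in the
    presented algebra. *)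
Lemma presentation_of (E : seq L) : (forall y, y \in E -> O y) ->
  exists K p, presents K p /\
    forall y, y \in E -> exists f s, prs_unit s /\ prs_eval p s * y = prs_eval p f.
Proof.
move=> hE; have [K [sK fK hK]] := fixable_all hE.
have [|p [gp hp]] := fK [seq y <- E | y != 0].
  by move=> y; rewrite mem_filter => /andP[y0 /hK].
exists K, p; split=> // y yE; case: (eqVneq y 0) => [->|y0].
  exists 0, 1; rewrite mulr0 rmorph0; split=> //.
  by rewrite /prs_unit rmorph1; apply: unitO1.
have [|a [s [u [[fa a0] us uu e]]]] := hp y; first by rewrite mem_filter y0.
have [s0 Os _] := us; have [u0 Ou Oui] := uu.
have [|d jd] := O_frac fa.
  have -> : a = prs_eval p s * y / prs_eval p u by rewrite e mulfK.
  by apply: subringM => //; apply: subringM => //; apply: hE.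
exists (prs_const p d * u), s; split=> //.
by rewrite e rmorphM (prs_evalC gp) jd.
Qed.

End Immediate.

Local Notation "x %:F" := (@FracField.tofrac _ x).

(** * Localizations inside the fraction field *)

Record denominators (R : idomainType) := Denominators {
  den : R -> Prop;
  den1 : den 1;
  denM : forall s t, den s -> den t -> den (s * t);
  den_neq0 : forall s, den s -> s != 0 }.

Section Localization.
Variables (R : idomainType) (S : denominators R).

(** The localization is realized as a subring of the fraction field; excluded middle makes
    membership boolean, which lets the ring structure be inherited. *)
Definition loc_pred : {pred {fraction R}} := fun y =>
  if excluded_middle_informative (exists f s, den S s /\ y * s%:F = f%:F) then true else false.

Lemma loc_predP y : reflect (exists f s, den S s /\ y * s%:F = f%:F) (y \in loc_pred).
Proof.
by rewrite unfold_in /=; case: excluded_middle_informative => h; constructor.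
Qed.

Lemma loc_subring : subring_closed loc_pred.
Proof.
split.
- by apply/loc_predP; exists 1, 1; rewrite mul1r; split=> //; apply: den1.
- move=> y z /loc_predP[f [s [Ss e]]] /loc_predP[g [t [St e']]]; apply/loc_predP.
  exists (f * t - g * s), (s * t); split; first exact: denM.
  by rewrite !(rmorphB, rmorphM) /= -e -e'; ring.
- move=> y z /loc_predP[f [s [Ss e]]] /loc_predP[g [t [St e']]]; apply/loc_predP.
  exists (f * g), (s * t); split; first exact: denM.
  by rewrite !rmorphM /= -e -e'; ring.
Qed.

HB.instance Definition _ := GRing.isSubringClosed.Build {fraction R} loc_pred loc_subring.

Record loc := Loc { loc_val; _ : loc_val \in loc_pred }.

HB.instance Definition _ := [isSub for loc_val].
HB.instance Definition _ := [Choice of loc by <:].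
HB.instance Definition _ := [SubChoice_isSubComNzRing of loc by <:].

Lemma loc_inP (f : R) : f%:F \in loc_pred.
Proof. by apply/loc_predP; exists f, 1; rewrite rmorph1 mulr1; split=> //; apply: den1. Qed.

Definition loc_in (f : R) : loc := Loc (loc_inP f).

Lemma loc_in_zmod : zmod_morphism loc_in.
Proof. by move=> f g; apply: val_inj; rewrite /= rmorphB. Qed.

Lemma loc_in_monoid : monoid_morphism loc_in.
Proof. by split=> [|f g]; apply: val_inj; rewrite /= ?rmorph1 ?rmorphM. Qed.

HB.instance Definition _ := GRing.isZmodMorphism.Build R loc loc_in loc_in_zmod.
HB.instance Definition _ := GRing.isMonoidMorphism.Build R loc loc_in loc_in_monoid.

Lemma loc_in_inj : injective loc_in.
Proof. by move=> f g /(congr1 val) /= /eqP; rewrite tofrac_eq => /eqP. Qed.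

Lemma loc_frac (c : loc) : exists f s, den S s /\ c * loc_in s = loc_in f.
Proof.
by case: c => y hy; have /loc_predP[f [s [Ss e]]] := hy; exists f, s; split=> //; apply: val_inj.
Qed.

Lemma loc_unit s : den S s -> exists c : loc, loc_in s * c = 1.
Proof.
move=> Ss; have s0 : s%:F != 0 by rewrite tofrac_eq0 (den_neq0 Ss).
have hc : s%:F^-1 \in loc_pred by apply/loc_predP; exists 1, s; rewrite mulVf.
by exists (Loc hc); apply: val_inj; rewrite /= mulfV.
Qed.

End Localization.

(** * Maps out of a localization *)

Section Lift.
Variables (R W : idomainType) (L : fieldType) (S : denominators R).
Variables (emb : {rmorphism W -> L}) (ev : {rmorphism R -> L}).
Hypothesis emb_inj : injective emb.
Hypothesis ev_emb : forall f, exists w, emb w = ev f.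
Hypothesis ev_den : forall s, den S s -> exists w, emb w * ev s = 1.

(** Two fractions representing c are compared by cross-multiplication in [R], so one w serves all of
    them. *)
Lemma loc_lift_ex (c : loc S) : exists w, forall f s, den S s ->
  c * loc_in S s = loc_in S f -> emb w * ev s = ev f.
Proof.
have [f [s [Ss e]]] := loc_frac c; have [w ew] := ev_emb f; have [v hv] := ev_den Ss.
exists (w * v) => g t St e'.
have : loc_in S (g * s) = loc_in S (f * t) by rewrite !rmorphM /= -e -e'; ring.
move/loc_in_inj => h; have := congr1 ev h; rewrite !rmorphM ew => {}h.
by rewrite mulrAC -h -mulrA [ev s * _]mulrC hv mulr1.
Qed.

Definition loc_lift (c : loc S) : W := proj1_sig (constructive_indefinite_description _ (loc_lift_ex c)).

Lemma loc_liftP c f s : den S s -> c * loc_in S s = loc_in S f -> emb (loc_lift c) * ev s = ev f.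
Proof. by rewrite /loc_lift; case: constructive_indefinite_description => w /= h; apply: h. Qed.

Lemma ev_den_neq0 s : den S s -> ev s != 0.
Proof.
move=> Ss; have [w e] := ev_den Ss; apply/negP => /eqP h.
by move/eqP: e; rewrite h mulr0 eq_sym oner_eq0.
Qed.

Lemma loc_lift_eq c w f s : den S s -> c * loc_in S s = loc_in S f -> emb w * ev s = ev f ->
  loc_lift c = w.
Proof.
move=> Ss e ew; apply: emb_inj; apply: (mulIf (ev_den_neq0 Ss)).
by rewrite ew (loc_liftP Ss e).
Qed.

Lemma loc_lift_zmod : zmod_morphism loc_lift.
Proof.
move=> c d; have [f [s [Ss e]]] := loc_frac c; have [g [t [St e']]] := loc_frac d.
apply: (loc_lift_eq (f := f * t - g * s) (s := s * t)); first exact: denM.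
  by rewrite !(rmorphB, rmorphM) /= -e -e'; ring.
by rewrite !(rmorphB, rmorphM) -(loc_liftP Ss e) -(loc_liftP St e'); ring.
Qed.

Lemma loc_lift_monoid : monoid_morphism loc_lift.
Proof.
split=> [|c d].
  by apply: (loc_lift_eq (f := 1) (s := 1)); rewrite ?rmorph1 ?mulr1 //; apply: den1.
have [f [s [Ss e]]] := loc_frac c; have [g [t [St e']]] := loc_frac d.
apply: (loc_lift_eq (f := f * g) (s := s * t)); first exact: denM.
  by rewrite !rmorphM /= -e -e'; ring.
by rewrite !rmorphM -(loc_liftP Ss e) -(loc_liftP St e'); ring.
Qed.

HB.instance Definition _ := GRing.isZmodMorphism.Build (loc S) W loc_lift loc_lift_zmod.
HB.instance Definition _ := GRing.isMonoidMorphism.Build (loc S) W loc_lift loc_lift_monoid.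

Definition loc_morphism : {rmorphism loc S -> W} := loc_lift.

Lemma gen_loc (P : seq R) (c : loc S) f s : den S s -> c * loc_in S s = loc_in S f ->
  gen (map (loc_in S) P) c <-> sat (den S) (gen P) f.
Proof.
move=> Ss e; have idP := gen_ideal P; split=> [h|[t [St ht]]].
  have [g [t [St e' ht]]] : exists g t, [/\ den S t, c * loc_in S t = loc_in S g & gen P g].
    pattern c; apply: h => [|p /mapP[q qP ->]]; last first.
      exists q, 1; rewrite rmorph1 mulr1; split=> //; [exact: den1 | exact: gen_mem].
    split=> // [|x y [g [t [St e1 h1]]] [g' [t' [St' e1' h1']]]|a x _ [g [t [St e1 h1]]]].
    - exists 0, 1; rewrite rmorph0 mul0r; split=> //; [exact: den1 | exact: is_ideal0].
    - exists (g * t' + g' * t), (t * t'); split; first exact: denM.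
        by rewrite rmorphD !rmorphM /= -e1 -e1'; ring.
      by apply: (is_idealD idP); apply: (is_idealMr _ idP).
    - have [b [u [Su eb]]] := loc_frac a; exists (b * g), (u * t); split; first exact: denM.
        by rewrite !rmorphM /= -e1 -eb; ring.
      exact: (is_idealMl _ idP).
  exists t; split=> //; have -> : t * f = s * g; last exact: (is_idealMl _ idP).
  by apply: (@loc_in_inj _ S); rewrite !rmorphM /= -e -e'; ring.
have [d hd] := loc_unit (denM St Ss).
have -> : c = d * loc_in S (t * f).
  by rewrite -[LHS]mulr1 -hd !rmorphM /= -e; ring.
by apply: (is_idealMl _ (gen_ideal _)); apply: gen_rmorph.
Qed.

Lemma loc_is_localization : is_localization (loc_in S) (den S).
Proof.
split.
- by split; [apply: den1 | apply: denM].
- exact: loc_unit.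
- by move=> c; have [f [s h]] := loc_frac c; exists f, s.
- move=> a a0; exists 1; split; first exact: den1.
  by rewrite mul1r; apply: (@loc_in_inj _ S); rewrite a0 rmorph0.
Qed.

(** Properness holds because 1 in the ideal would put some denominator in (P), although evaluation
    kills P and no denominator. *)
Lemma loc_regular P : reg_seq (den S) P -> (forall p, p \in P -> ev p = 0) ->
  regular_sequence (map (loc_in S) P).
Proof.
move=> hP P0; split.
  move=> k; rewrite size_map => kP x; rewrite -map_take (nth_map 0) // => /gen_in_ideal h.
  have [f [s [Ss e]]] := loc_frac x; apply/gen_in_ideal.
  have e' : x * loc_in S P`_k * loc_in S s = loc_in S (f * P`_k).
    by rewrite mulrAC e -[RHS]/(loc_in S (f * P`_k)) [RHS]rmorphM.
  by apply/(gen_loc _ Ss e); apply: hP => //; apply/(gen_loc (take k P) Ss e').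
move=> /gen_in_ideal h.
have e1 : 1 * loc_in S 1 = loc_in S 1 by rewrite mul1r.
have [s [Ss hs]] := (gen_loc P (den1 S) e1).1 h.
have := gen_rmorph0 P0 hs; rewrite mulr1 => /eqP.
by rewrite (negPf (ev_den_neq0 Ss)).
Qed.

Lemma loc_lift_in f : emb (loc_morphism (loc_in S f)) = ev f.
Proof.
have := @loc_liftP (loc_in S f) f 1 (den1 S); rewrite !rmorph1 !mulr1; exact.
Qed.

Lemma loc_lift_kernel P : (forall f, ev f = 0 <-> sat (den S) (gen P) f) ->
  forall c, loc_morphism c = 0 <-> in_ideal (map (loc_in S) P) c.
Proof.
move=> hP c; rewrite -[loc_morphism c]/(loc_lift c).
have [f [s [Ss e]]] := loc_frac c; rewrite -gen_in_ideal (gen_loc _ Ss e) -hP.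
rewrite -(loc_liftP Ss e); split=> [->|/eqP]; first by rewrite rmorph0 mul0r.
rewrite mulf_eq0 (negPf (ev_den_neq0 Ss)) orbF => /eqP h.
by apply: emb_inj; rewrite h rmorph0.
Qed.

Lemma loc_lift_image y : (exists c, loc_morphism c = y) <-> exists f s, den S s /\ emb y * ev s = ev f.
Proof.
split=> [[c <-]|[f [s [Ss e]]]].
  by have [f [s [Ss e]]] := loc_frac c; exists f, s; split=> //; apply: loc_liftP.
have [d hd] := loc_unit Ss; exists (loc_in S f * d); apply: (loc_lift_eq Ss _ e).
by rewrite -mulrA [d * _]mulrC hd mulr1.
Qed.

End Lift.

(** * The theorem *)

Lemma fraction_repr (R : idomainType) (y : {fraction R}) :
  exists a b : R, b != 0 /\ y = a%:F / b%:F.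
Proof.
elim/quotW: y => r; exists \n_r, \d_r; split; first exact: denom_ratioP.
have d0 : (\d_r)%:F != 0 by rewrite tofrac_eq0 denom_ratioP.
apply: (mulIf d0); rewrite divfK //; unlock FracField.tofrac.
rewrite -[LHS]FracField.pi_mul; apply/eqmodP; rewrite /= FracField.equivfE /FracField.mulf.
by rewrite !numden_Ratio ?mulf_neq0 ?denom_ratioP ?oner_eq0 // !mulr1 mulrC.
Qed.

Section Final.
Variables (V V' : idomainType) (i : {rmorphism V -> V'}).
Hypothesis imm : immediate_extension i.

Let L := {fraction V'}.
Let O (y : L) : Prop := exists v, y = v%:F.
Let j : {rmorphism V -> L} := (@FracField.tofrac V') \o i.

Lemma O_ring : subring O.
Proof.
split=> [|_ _ [x ->] [y ->]|_ _ [x ->] [y ->]].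
- by exists 1; rewrite rmorph1.
- by exists (x - y); rewrite rmorphB.
- by exists (x * y); rewrite rmorphM.
Qed.

Lemma O_total y : O y \/ O y^-1.
Proof.
have [[_ vV' _ _] _ _] := imm; have [a [b [b0 ->]]] := fraction_repr y.
have bF : b%:F != 0 by rewrite tofrac_eq0.
case: (vV' a b) => [[c e]|[c e]]; last by left; exists c; rewrite e rmorphM mulfK.
right; exists c; rewrite invf_div e rmorphM mulfK ?tofrac_eq0 //.
by apply: contraNneq b0 => a0; rewrite e a0 mulr0.
Qed.

Lemma i_inj : injective i. Proof. by case: imm => [[]]. Qed.

Lemma j_eq0 a : j a = 0 -> a = 0.
Proof. by move/eqP; rewrite /= tofrac_eq0 => /eqP h; apply: i_inj; rewrite h rmorph0. Qed.

Lemma O_j a : O (j a). Proof. by exists (i a). Qed.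

Lemma unitOP v : unitO O v%:F <-> runit v.
Proof.
split=> [[v0 _ [w e]]|[w e]].
  exists w; apply/eqP; rewrite -tofrac_eq rmorphM /= -e rmorph1 mulfV //.
have e' : v%:F * w%:F = 1 by rewrite -rmorphM e rmorph1.
have v0 : v%:F != 0.
  by apply/negP => /eqP h; move/eqP: e'; rewrite h mul0r eq_sym oner_eq0.
split=> //; [by exists v | exists w; apply: (mulfI v0); by rewrite e' mulfV].
Qed.

(** Frac V meets V' in V: if a / b = 1 / c with c in V, then c is a unit of V', hence of V by
    domination. *)
Lemma O_fracV y : in_frac j y -> O y -> exists a, j a = y.
Proof.
have [[vV _ _ loc] _ _] := imm.
move=> [a [b [b0 ->]]] [v e].
case: (vV a b) => [[c ec]|[c ec]]; last by exists c; rewrite ec rmorphM mulfK.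
case: (eqVneq (j a) 0) => a0; first by exists 0; rewrite a0 mul0r rmorph0.
have jc : j c != 0 by apply: contraNneq b0 => c0; rewrite ec rmorphM c0 mul0r.
have ab : j a / j b = (j c)^-1 by rewrite ec rmorphM invfM mulrCA divff // mulr1.
have ev : v%:F * j c = 1 by rewrite -e ab mulVf.
have [|d ed] := loc c.
  exists v; apply/eqP; rewrite -tofrac_eq rmorph1 rmorphM mulrC; exact/eqP.
exists d; rewrite ab.
apply: (mulfI jc); rewrite mulfV //.
by rewrite -rmorphM ed rmorph1.
Qed.

(** For y in V', the value group supplies a / b and the residue field approximates the remaining
    unit; otherwise the inverse of y is in V' and its approximation is inverted. *)
Lemma immediateV y : y != 0 -> exists a, in_frac j a /\ maxO O ((y - a) / y).
Proof.
have [_ sv sr] := imm.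
have inO v : v != 0 -> exists a, in_frac j a /\ maxO O ((v%:F - a) / v%:F).
  move=> v0; have [a [b [b0 [[c ec] [d ed]]]]] := sv v v0.
  have vF : v%:F != 0 by rewrite tofrac_eq0.
  have jb : j b != 0 by apply: contraNneq b0 => /j_eq0->.
  have ja : j a != 0.
    rewrite /= tofrac_eq0; apply: contraNneq v0 => a0; move/eqP: ed; rewrite a0 mulr0 mulf_eq0.
    by rewrite -(rmorph0 i) (inj_eq i_inj) (negPf b0).
  have ebv : j b * v%:F = j a * d%:F.
    by have := congr1 (@FracField.tofrac V') ed; rewrite !rmorphM => ->; rewrite mulrC.
  have eav : j a = c%:F * (j b * v%:F).
    by have := congr1 (@FracField.tofrac V') ec; rewrite !rmorphM.
  have cd : c%:F * d%:F = 1.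
    by apply: (mulfI ja); rewrite mulr1 {2}eav ebv mulrCA.
  have [r hr] := sr d; exists (j a / j b * j r); split.
    apply: fracM; [by exists a, b | exact: frac_j].
  rewrite (approx_unit _ ja jb ebv cd) -rmorphB.
  apply: maxOMl; [exact: O_ring | by exists c | split; first by exists (d - i r)].
  by move/unitOP.
move=> y0; case: (O_total y) => [[v e]|[v e]].
  by rewrite e; apply: inO; rewrite -tofrac_eq0 -e.
have v0 : v != 0 by rewrite -tofrac_eq0 -e invr_eq0.
have [a [fa ma]] := inO v v0; rewrite -e in ma.
have [a0 ma'] := approx_inv O_ring O_total y0 ma.
by exists a^-1; split=> //; apply: fracV.
Qed.

(** For directedness: the images of the variables generate A once units of V' may be divided out, so
    containing A is a condition on finitely many elements. *)
Lemma ci_subalgebra_generators (A : V' -> Prop) : ci_subalgebra i A ->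
  exists E : seq V', forall D : V' -> Prop, subring D -> (forall a, D (i a)) ->
    (forall x y, D x -> D (x * y) -> runit x -> D y) ->
    (forall y, y \in E -> D y) -> forall y, A y -> D y.
Proof.
case=> _ [n [C [jC [S [P [phi [[_ uS fr _] _ phiC hA _]]]]]]].
exists [seq phi (jC 'X_m) | m <- enum 'I_n] => D rD Di Ddiv hE.
have poly q : D (phi (jC q)).
  rewrite (mpolyE q) !rmorph_sum; apply: subring_sum => // m _ /=.
  rewrite -mul_mpolyC !rmorphM; apply: (subringM rD); first by rewrite phiC.
  rewrite mpolyXE_id !rmorph_prod; apply: big_ind => [||l _]; first exact: (subring1 rD).
    by move=> ? ?; apply: (subringM rD).
  rewrite !rmorphXn; apply: (subringX rD); apply: hE.
  by apply: (map_f (fun m => phi (jC 'X_m))); rewrite mem_enum.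
move=> y /hA[c <-]; have [a [s [Ss e]]] := fr c.
apply: (Ddiv (phi (jC s))) => //; first by rewrite -rmorphM mulrC e.
by have [d ed] := uS s Ss; exists (phi d); rewrite -rmorphM ed rmorph1.
Qed.

(** * The subalgebra of V' given by a presentation *)

Section Presented.
Variables (K : L -> Prop) (p : presentation V L).
Hypothesis gp : presents O j K p.

Definition prs_image (y : V') : Prop := exists f s,
  prs_unit O s /\ prs_eval p s * y%:F = prs_eval p f.

Lemma prs_image_eval f : exists y, prs_eval p f = y%:F /\ prs_image y.
Proof.
have [y ey] := prs_O gp f; exists y; split=> //; exists f, 1.
by rewrite rmorph1 mul1r -ey; split=> //; rewrite /prs_unit rmorph1; apply: unitO1 O_ring.
Qed.

Lemma prs_image_ring : subring prs_image.
Proof.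
have SM s t : prs_unit O s -> prs_unit O t -> @prs_unit V L O p (s * t).
  by rewrite /prs_unit rmorphM; apply: (unitOM O_ring).
split.
- by exists 1, 1; rewrite !rmorph1 mul1r; split=> //; rewrite /prs_unit rmorph1; apply: unitO1 O_ring.
- move=> x y [f [s [us e]]] [g [t [ut e']]]; exists (f * t - g * s), (s * t).
  by split; [apply: SM | rewrite !(rmorphB, rmorphM) -e -e'; ring].
- move=> x y [f [s [us e]]] [g [t [ut e']]]; exists (f * g), (s * t).
  by split; [apply: SM | rewrite !rmorphM -e -e'; ring].
Qed.

Lemma prs_image_div x y : prs_image x -> prs_image (x * y) -> runit x -> prs_image y.
Proof.
move=> [f [s [us e]]] [g [t [ut e']]] /unitOP ux.
have uf : prs_unit O f by rewrite /prs_unit -e; apply: (unitOM O_ring).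
have [s0 _ _] := us; have [t0 _ _] := ut; have [f0 _ _] := uf; have [x0 _ _] := ux.
exists (g * s), (t * f); split; first by rewrite /prs_unit rmorphM; apply: (unitOM O_ring).
by rewrite !rmorphM -e -e' rmorphM; ring.
Qed.

(** Closure under division by units of V' makes every nonunit of the image a nonunit of V', so the
    nonunits lie in the maximal ideal of O. *)
Lemma prs_image_local : local_subring prs_image.
Proof.
move=> x y Ax Ay nx ny [z [Az ez]].
have maxA w : prs_image w -> ~ (exists z, prs_image z /\ w * z = 1) -> maxO O w%:F.
  move=> Aw nw; split; first by exists w.
  move/unitOP => [v ev]; apply: nw; exists v; split=> //; apply: (prs_image_div Aw).
    by rewrite ev; apply: subring1 prs_image_ring.
  by exists v.
have := maxOD O_ring O_total (maxA x Ax nx) (maxA y Ay ny).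
by rewrite -rmorphD => -[_]; apply; apply/unitOP; exists z.
Qed.

(** The presentation is carried along [g] to a genuine multivariate polynomial ring and localized at
    the elements whose value is a unit of O. *)
Lemma prs_image_ci : ci_subalgebra i prs_image.
Proof.
split; first exact: prs_image_local.
have [n [f [g [fK gK fC]]]] := prs_alg gp.
pose ev : {rmorphism {mpoly V[n]} -> L} := prs_eval p \o f.
have d1 : unitO O (ev 1) by rewrite rmorph1; apply: unitO1 O_ring.
have dM s t : unitO O (ev s) -> unitO O (ev t) -> unitO O (ev (s * t)).
  by rewrite rmorphM; apply: (unitOM O_ring).
have d0 s : unitO O (ev s) -> s != 0.
  by case=> h _ _; apply: contraNneq h => ->; rewrite rmorph0.
pose S := Denominators d1 dM d0.
pose P := map g (prs_rels p).
have emb_inj : injective (@FracField.tofrac V') by move=> x y /eqP; rewrite tofrac_eq => /eqP.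
have ev_emb q : exists w, w%:F = ev q by have [w e] := prs_O gp (f q); exists w.
have ev_den s : den S s -> exists w, w%:F * ev s = 1.
  by move=> [s0 _ [w e]]; exists w; rewrite -e mulVf.
have satP I I' q : (forall y, I (g y) <-> I' y) ->
    sat (den S) I q <-> sat (@prs_unit V L O p) I' (f q).
  move=> h; split=> [[s [us hs]]|[s [us hs]]].
    by exists (f s); split=> //; apply/h; rewrite rmorphM !fK.
  by exists (g s); split; [rewrite /den /= /ev /= gK | rewrite -[q]fK -rmorphM; apply/h].
have genP Q y : gen (map g Q) (g y) <-> gen Q y.
  split=> [/(gen_rmorph (f := f))|/(gen_rmorph (f := g)) //]; rewrite gK -map_comp.
  by rewrite (eq_map (g := id)) ?map_id // => z /=; rewrite gK.
have P0 q : q \in P -> ev q = 0.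
  by move=> /mapP[y yP ->]; rewrite /ev /= gK; apply: (prs_rels0 gp).
exists n, (loc S), (loc_in S), (den S), (map (loc_in S) P), (loc_morphism emb_inj ev_emb ev_den).
split.
- exact: loc_is_localization.
- apply: (loc_regular ev_den) => // k q; rewrite size_map => kP.
  rewrite -map_take; move/(satP _ _ _ (genP _)); rewrite (nth_map 0) // rmorphM gK => h.
  by apply/(satP _ _ _ (genP _)); apply: (prs_reg gp).
- by move=> a; apply/emb_inj; rewrite loc_lift_in /ev /= fC (prs_evalC gp).
- move=> y; rewrite loc_lift_image; split=> [[h [s [us e]]]|[h [s [us e]]]].
    by exists (g h), (g s); split; [rewrite /= /ev /= gK | rewrite mulrC /ev /= !gK].
  by exists (f h), (f s); split=> //; rewrite mulrC.
- apply: loc_lift_kernel => q; rewrite (satP _ _ _ (genP _)); split=> [/(prs_ker gp) //|[s [us hs]]].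
  have := gen_rmorph0 (prs_rels0 gp) hs; rewrite rmorphM => /eqP.
  by case: us => s0 _ _; rewrite mulf_eq0 (negPf s0) => /eqP.
Qed.

End Presented.

End Final.

Theorem theorem6 (V V' : idomainType) (i : {rmorphism V -> V'}) :
  immediate_extension i -> contains_field V ->
  filtered_union (ci_subalgebra i).
Proof.
move=> imm [k [ik _]].
pose O (y : {fraction V'}) : Prop := exists v, y = v%:F.
have pres (E : seq V') : exists K p, presents O (@FracField.tofrac V' \o i) K p /\
    forall y, y \in E -> prs_image p y.
  have [|K [p [gp hp]]] := presentation_of ik (@O_ring V') (O_total imm) (j_eq0 imm)
    (O_j i) (O_fracV imm) (immediateV imm) (E := map (@FracField.tofrac V') E).
    by move=> _ /mapP[y _ ->]; exists y.
  by exists K, p; split=> // y yE; apply: hp; apply: map_f.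
split=> [y|A B hA hB].
  have [K [p [gp hp]]] := pres [:: y].
  exists (prs_image p); split; last by apply: hp; rewrite inE.
  exact: prs_image_ci gp.
(* An upper bound for A and B is obtained by presenting an algebra that contains the finitely many
   generators of both. *)
have [E hE] := ci_subalgebra_generators hA; have [F hF] := ci_subalgebra_generators hB.
have [K [p [gp hp]]] := pres (E ++ F).
have rD := prs_image_ring p.
have Di a : prs_image p (i a).
  have [y [ey Ay]] := prs_image_eval gp (prs_const p a).
  suff -> : i a = y by [].
  by apply/eqP; rewrite -tofrac_eq -ey (prs_evalC gp).
exists (prs_image p); split; first exact: prs_image_ci gp.
split=> y.
  by apply: hE => // [a b|z zE]; [apply: prs_image_div | apply: hp; rewrite mem_cat zE].
by apply: hF => // [a b|z zF]; [apply: prs_image_div | apply: hp; rewrite mem_cat zF orbT].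
Qed.
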